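(* Let $(B,+,\circ)$ be a Dedekind skew brace. If $B$ satisfies one of the following conditions: $B$ is finite, $B$ is almost polycyclic, $B$ is supersoluble; then $B$ is centrally nilpotent. If $B$ satisfies one of the following conditions: $B$ is locally finite, $B$ is soluble, $B$ is hypercyclic, $B$ is hypermultipermutational; then $B$ is hypercentral.
   Context: A skew brace is a triple $(B,+,\circ)$ with $(B,+)$, $(B,\circ)$ (not necessarily abelian) groups such that $a\circ(b+c)=a\circ b-a+a\circ c$ for all $a,b,c\in B$. The identities of the two groups coincide and are denoted by $0$. For $a\in B$ put $\lambda_a(b)=-a+a\circ b$; then $\lambda:a\mapsto\lambda_a$ is a homomorphism $(B,\circ)\to\operatorname{Aut}(B,+)$. A sub-skew brace is a subset that is a subgroup of both $(B,+)$ and $(B,\circ)$. An ideal is a subgroup of $(B,+)$ that is normal in $(B,+)$, invariant under all $\lambda_b$, and normal in $(B,\circ)$; one can form the quotient skew brace $B/I$. $B$ is Dedekind if all its sub-skew braces are ideals of $B$. $B$ is trivial if $a+b=a\circ b$ for all $a,b\in B$, and abelian if it is trivial and $(B,+)$ is abelian. The socle is $\operatorname{Soc}(B)=\operatorname{Ker}(\lambda)\cap Z(B,+)$ and the centre is $Z(B)=\operatorname{Soc}(B)\cap Z(B,\circ)$; both are ideals. The upper central series is $Z_0(B)=\{0\}$, $Z_{\alpha+1}(B)/Z_\alpha(B)=Z(B/Z_\alpha(B))$, with unions at limit ordinals; the upper socle series is $\operatorname{Soc}_0(B)=\{0\}$, $\operatorname{Soc}_{\alpha+1}(B)/\operatorname{Soc}_\alpha(B)=\operatorname{Soc}(B/\operatorname{Soc}_\alpha(B))$,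 with unions at limit ordinals. $B$ is centrally nilpotent if $B=Z_n(B)$ for some non-negative integer $n$; hypercentral if $B=Z_\alpha(B)$ for some ordinal $\alpha$; hypermultipermutational if $B=\operatorname{Soc}_\alpha(B)$ for some ordinal $\alpha$. $B$ is locally finite if every finitely generated sub-skew brace is finite. $B$ is soluble if it has a finite series of ideals $\{0\}=B_0\leq B_1\leq\dots\leq B_n=B$ with abelian factors. $B$ is almost polycyclic if it has a finite series of ideals $\{0\}=B_0\leq\dots\leq B_n=B$ such that for each $0\leq i<n$ either $B_{i+1}/B_i\leq\operatorname{Soc}(B/B_i)$ and $B_{i+1}/B_i$ is finitely generated, or $B_{i+1}/B_i$ is finite. $B$ is supersoluble if it has a finite series of ideals $\{0\}=B_0\leq\dots\leq B_n=B$ such that for each $0\leq i<n$ either $B_{i+1}/B_i\leq\operatorname{Soc}(B/B_i)$ and $B_{i+1}/B_i$ is infinite cyclic, or $B_{i+1}/B_i$ has prime order. $B$ is hypercyclic if it has an ascending (ordinal-indexed, with unions at limit ordinals) series of ideals from $\{0\}$ to $B$ whose factors satisfy the same conditions as in the supersoluble case. *)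

(* Defs.v *)
From HB Require Import structures.
From mathcomp Require Import all_boot all_classical wochoice.
Set Implicit Arguments.
Unset Strict Implicit.
Unset Printing Implicit Defensive.

Local Open Scope classical_set_scope.
Local Open Scope quotient_scope.

(* MathComp's additive groups are abelian and its [groupType] is
   multiplicative, hence this not necessarily abelian additive group. *)
HB.mixin Record isAddGroup G of Choice G := {
  gzero : G;
  gopp : G -> G;
  gadd : G -> G -> G;
  gaddA : forall a b c, gadd a (gadd b c) = gadd (gadd a b) c;
  gadd0 : forall a, gadd gzero a = a;
  gaddN : forall a, gadd (gopp a) a = gzero
}.

#[short(type="addGroupType")]
HB.structure Definition AddGroup := {G of isAddGroup G & Choice G}.

Declare Scope brace_scope.
Delimit Scope brace_scope with brace.
Open Scope brace_scope.

Notation "0" := (@gzero _) : brace_scope.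
Notation "a + b" := (gadd a b) : brace_scope.
Notation "- a" := (gopp a) : brace_scope.
Notation "a - b" := (gadd a (gopp b)) : brace_scope.
(* The group (B,∘) is the multiplicative group of a MathComp [groupType]. *)
Notation "a ∘ b" := (a%brace * b%brace)%g
  (at level 40, left associativity) : brace_scope.

HB.mixin Record isSkewBrace B of Group B & AddGroup B := {
  gmulD : forall a b c : B, a ∘ (b + c) = a ∘ b - a + a ∘ c
}.

#[short(type="skewBraceType")]
HB.structure Definition SkewBrace := {B of isSkewBrace B & Group B & AddGroup B}.

Bind Scope brace_scope with AddGroup.sort SkewBrace.sort.

Section Elementary.
Variable B : skewBraceType.
Implicit Types a b c : B.

Definition lambda a b : B := - a + a ∘ b.

Lemma gaddKN a b : - a + (a + b) = b.
Proof. by rewrite gaddA gaddN gadd0. Qed.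

Lemma gaddI a b c : a + b = a + c -> b = c.
Proof. by move=> /(congr1 (fun x => - a + x)); rewrite !gaddKN. Qed.

Lemma gaddr0 a : a + 0 = a.
Proof. by apply: (@gaddI (- a)); rewrite gaddKN gaddN. Qed.

Lemma gaddNr a : a - a = 0.
Proof. by apply: (@gaddI (- a)); rewrite gaddKN gaddr0. Qed.

Lemma gopp_K a : - - a = a.
Proof. by apply: (@gaddI (- a)); rewrite gaddN gaddNr. Qed.

Lemma gadd_NK a b : a + (- a + b) = b.
Proof. by rewrite gaddA gaddNr gadd0. Qed.

Lemma goppD a b : - (a + b) = - b - a.
Proof.
apply: (@gaddI (a + b)).
by rewrite gaddNr -gaddA gadd_NK gaddNr.
Qed.

Lemma gmulE a b : a ∘ b = a + lambda a b.
Proof. by rewrite /lambda gadd_NK. Qed.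

Lemma gmul0 a : a ∘ 0 = a.
Proof.
have := gmulD a 0 0.
rewrite gadd0 -gaddA -{1}[a ∘ 0]gaddr0.
by move=> /gaddI /(congr1 (fun x => a + x));
   rewrite gadd_NK gaddr0.
Qed.

Lemma brace1E : 1%g = 0 :> B.
Proof. by rewrite -[RHS]mul1g gmul0. Qed.

Lemma lambda1 a : lambda 1%g a = a.
Proof. by rewrite /lambda mul1g brace1E -[RHS](gaddKN 0) gadd0. Qed.

Lemma lambdaD a b c : lambda a (b + c) = lambda a b + lambda a c.
Proof. by rewrite /lambda gmulD !gaddA. Qed.

Lemma lambdaN a b : lambda a (- b) = - lambda a b.
Proof.
apply: (@gaddI (lambda a b)).
by rewrite -lambdaD !gaddNr /lambda gmul0 gaddN.
Qed.

Lemma lambdaM a b c : lambda (a ∘ b) c = lambda a (lambda b c).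
Proof.
rewrite [lambda b c]/lambda lambdaD lambdaN /lambda goppD gopp_K.
by rewrite mulgA -!gaddA gadd_NK.
Qed.

End Elementary.

Section Substructures.
Variable B : skewBraceType.

Definition is_subgroup (T : Type) (op : T -> T -> T) (e : T) (inv : T -> T)
    (S : set T) : Prop :=
  [/\ S e, (forall x y, S x -> S y -> S (op x y)) & (forall x, S x -> S (inv x))].

Definition is_normal_subgroup (T : Type) (op : T -> T -> T) (e : T)
    (inv : T -> T) (S : set T) : Prop :=
  is_subgroup op e inv S /\ (forall x y, S x -> S (op (op y x) (inv y))).

Definition add_subgroup (S : set B) : Prop :=
  is_subgroup (fun a b : B => a + b) 0 (fun a : B => - a) S.

Definition circ_subgroup (S : set B) : Prop :=
  is_subgroup (fun a b : B => a ∘ b) 1%g (fun a : B => a^-1%g) S.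

Definition sub_skew_brace (S : set B) : Prop :=
  add_subgroup S /\ circ_subgroup S.

Definition is_ideal (I : set B) : Prop :=
  [/\ is_normal_subgroup (fun a b : B => a + b) 0 (fun a : B => - a) I,
      (forall b a : B, I a -> I (lambda b a))
    & is_normal_subgroup (fun a b : B => a ∘ b) 1%g (fun a : B => a^-1%g) I].

Record ideal : Type := Ideal {
  ideal_set :> set B;
  ideal_isP : is_ideal ideal_set
}.

Definition socle : set B :=
  [set a : B | (forall b : B, lambda a b = b) /\
               (forall b : B, a + b = b + a)].

Definition centre : set B :=
  [set a : B | socle a /\ (forall b : B, a ∘ b = b ∘ a)].

Definition finitely_generated (S : set B) : Prop :=
  exists X : set B, finite_set X /\ S = smallest sub_skew_brace X.

End Substructures.

Arguments socle B : clear implicits.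
Arguments centre B : clear implicits.

Section Quotient.
Variables (B : skewBraceType) (I : ideal B).
Implicit Types a b : B.

Let ID a b : ideal_set I a -> ideal_set I b -> ideal_set I (a + b).
Proof. by case: (ideal_isP I) => [[[_ + _] _] _ _]; apply. Qed.
Let IN a : ideal_set I a -> ideal_set I (- a).
Proof. by case: (ideal_isP I) => [[[_ _ +] _] _ _]; apply. Qed.
Let IJ a b : ideal_set I a -> ideal_set I (b + a - b).
Proof. by case: (ideal_isP I) => [[_ +] _ _]; apply. Qed.
Let IL b a : ideal_set I a -> ideal_set I (lambda b a).
Proof. by case: (ideal_isP I) => [_ + _]; apply. Qed.
Let IM a b : ideal_set I a -> ideal_set I b -> ideal_set I (a ∘ b).
Proof. by case: (ideal_isP I) => [_ _ [[_ + _] _]]; apply. Qed.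
Let IV a : ideal_set I a -> ideal_set I (a^-1)%g.
Proof. by case: (ideal_isP I) => [_ _ [[_ _ +] _]]; apply. Qed.
Let IC a b : ideal_set I a -> ideal_set I (b ∘ a ∘ b^-1%g).
Proof. by case: (ideal_isP I) => [_ _ [_ +]]; apply. Qed.

Definition ideal_rel : rel B := fun x y => `[< ideal_set I (- x + y) >].

Lemma ideal_rel_equiv : equiv_class_of ideal_rel.
Proof.
apply: EquivClass.
- move=> x; apply/asboolP; rewrite gaddN.
  by case: (ideal_isP I) => [[[]]].
- suff H x y : ideal_rel x y -> ideal_rel y x.
    by move=> x y; apply/idP/idP; apply: H.
  by move=> /asboolP/IN; rewrite goppD gopp_K => ?; apply/asboolP.
- move=> y x z /asboolP xy /asboolP yz; apply/asboolP.
  by have := ID xy yz; rewrite -gaddA gadd_NK.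
Qed.

Canonical ideal_equiv : equiv_rel B := EquivRelPack ideal_rel_equiv.

Definition quot : Type := {eq_quot ideal_equiv}.
HB.instance Definition _ := Choice.on quot.
HB.instance Definition _ := EqQuotient.on quot.

Definition quot_pi (x : B) : quot := \pi_quot x.

Lemma quotP (x y : B) : quot_pi x = quot_pi y <-> ideal_set I (- x + y).
Proof. by split=> [/eqmodP/asboolP|H]; last exact/eqmodP/asboolP. Qed.

(* The cosets of [I] in the two groups coincide. *)
Lemma quot_circP (x y : B) : quot_pi x = quot_pi y <-> ideal_set I (x^-1%g ∘ y).
Proof.
have E : - x + y = lambda x (x^-1%g ∘ y) by rewrite /lambda mulgA mulgV mul1g.
by rewrite quotP E; split=> [/(IL x^-1%g)|/(IL x)//]; rewrite -lambdaM mulVg lambda1.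
Qed.

Lemma quot_reprK (x : quot) : quot_pi (repr x) = x.
Proof. exact: reprK. Qed.

Definition quot_add (x y : quot) : quot := quot_pi (repr x + repr y).
Definition quot_opp (x : quot) : quot := quot_pi (- repr x).
Definition quot_mul (x y : quot) : quot := quot_pi (repr x ∘ repr y).
Definition quot_inv (x : quot) : quot := quot_pi (repr x)^-1%g.

Lemma quot_piD (x y : B) : quot_pi (x + y) = quot_add (quot_pi x) (quot_pi y).
Proof.
have /quotP xr : quot_pi x = quot_pi (repr (quot_pi x)) by rewrite quot_reprK.
have /quotP yr : quot_pi y = quot_pi (repr (quot_pi y)) by rewrite quot_reprK.
apply/quotP; rewrite goppD.
move: (repr _) (repr _) xr yr => x' y' xr yr.
have := ID (IJ (- y) xr) yr; rewrite gopp_K -!gaddA.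
by rewrite gadd_NK -?gaddA.
Qed.

Lemma quot_piN (x : B) : quot_pi (- x) = quot_opp (quot_pi x).
Proof.
have /quotP : quot_pi (repr (quot_pi x)) = quot_pi x by rewrite quot_reprK.
rewrite /quot_opp; move: (repr _) => x' H; apply/quotP; rewrite gopp_K.
by have := IJ x' H; rewrite gadd_NK.
Qed.

Lemma quot_piM (x y : B) : quot_pi (x ∘ y) = quot_mul (quot_pi x) (quot_pi y).
Proof.
have /quot_circP xr : quot_pi x = quot_pi (repr (quot_pi x)).
  by rewrite quot_reprK.
have /quot_circP yr : quot_pi y = quot_pi (repr (quot_pi y)).
  by rewrite quot_reprK.
apply/quot_circP.
move: (repr _) (repr _) xr yr => x' y' xr yr.
have := IM (IC y^-1%g xr) yr.
by rewrite invgK -!mulgA mulVKg invgM !mulgA.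
Qed.

Lemma quot_piV (x : B) : quot_pi x^-1%g = quot_inv (quot_pi x).
Proof.
have /quot_circP : quot_pi (repr (quot_pi x)) = quot_pi x by rewrite quot_reprK.
rewrite /quot_inv; move: (repr _) => x' H; apply/quot_circP; rewrite invgK.
by have := IC x' H; rewrite mulVKg.
Qed.

Lemma quot_ind (P : quot -> Prop) :
  (forall x : B, P (quot_pi x)) -> forall x : quot, P x.
Proof. by move=> H x; rewrite -(quot_reprK x). Qed.

Fact quot_addA x y z :
  quot_add x (quot_add y z) = quot_add (quot_add x y) z.
Proof.
elim/quot_ind: x => x; elim/quot_ind: y => y; elim/quot_ind: z => z.
by rewrite -!quot_piD gaddA.
Qed.
Fact quot_add0 x : quot_add (quot_pi 0) x = x.
Proof. by elim/quot_ind: x => x; rewrite -quot_piD gadd0. Qed.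
Fact quot_addN x : quot_add (quot_opp x) x = quot_pi 0.
Proof. by elim/quot_ind: x => x; rewrite -quot_piN -quot_piD gaddN. Qed.
HB.instance Definition _ :=
  isAddGroup.Build quot quot_addA quot_add0 quot_addN.

Fact quot_mulA x y z :
  quot_mul x (quot_mul y z) = quot_mul (quot_mul x y) z.
Proof.
elim/quot_ind: x => x; elim/quot_ind: y => y; elim/quot_ind: z => z.
by rewrite -!quot_piM mulgA.
Qed.
Fact quot_mul1 x : quot_mul (quot_pi 1%g) x = x.
Proof. by elim/quot_ind: x => x; rewrite -quot_piM mul1g. Qed.
Fact quot_1mul x : quot_mul x (quot_pi 1%g) = x.
Proof. by elim/quot_ind: x => x; rewrite -quot_piM mulg1. Qed.
Fact quot_mulV x : quot_mul (quot_inv x) x = quot_pi 1%g.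
Proof. by elim/quot_ind: x => x; rewrite -quot_piV -quot_piM mulVg. Qed.
Fact quot_Vmul x : quot_mul x (quot_inv x) = quot_pi 1%g.
Proof. by elim/quot_ind: x => x; rewrite -quot_piV -quot_piM mulgV. Qed.
HB.instance Definition _ :=
  isGroup.Build quot quot_mulA quot_mul1 quot_1mul quot_mulV quot_Vmul.

Fact quot_mulD (x y z : quot) : x ∘ (y + z) = x ∘ y - x + x ∘ z.
Proof.
elim/quot_ind: x => x; elim/quot_ind: y => y; elim/quot_ind: z => z.
change (quot_mul (quot_pi x) (quot_add (quot_pi y) (quot_pi z)) =
  quot_add (quot_add (quot_mul (quot_pi x) (quot_pi y)) (quot_opp (quot_pi x)))
    (quot_mul (quot_pi x) (quot_pi z))).
by rewrite -!(quot_piD, quot_piM, quot_piN) gmulD.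
Qed.
HB.instance Definition _ := isSkewBrace.Build quot quot_mulD.

(* J/I, as a subset of B/I *)
Definition factor (J : set B) : set quot := [set quot_pi x | x in J].

End Quotient.

Arguments quot_pi {B} I x.
Arguments factor {B} I J.

Definition dedekind (B : skewBraceType) : Prop :=
  forall S : set B, sub_skew_brace S -> is_ideal S.

(* Conditions on a factor J/I of a series of ideals: they are stated for a
   subset of a skew brace and applied to J/I inside the quotient B/I. *)
Definition factor_condition := forall Q : skewBraceType, set Q -> Prop.

Definition is_centre : factor_condition := fun Q A => A = centre Q.

Definition is_socle : factor_condition := fun Q A => A = socle Q.

Definition abelian_factor : factor_condition := fun Q A =>
  forall a b : Q, A a -> A b -> a + b = a ∘ b /\ a + b = b + a.

Definition polycyclic_factor : factor_condition := fun Q A =>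
  (A `<=` socle Q /\ finitely_generated A) \/ finite_set A.

Definition infinite_cyclic (Q : skewBraceType) (A : set Q) : Prop :=
  infinite_set A /\ exists g : Q, A = smallest (@add_subgroup Q) [set g].

Definition prime_order (Q : skewBraceType) (A : set Q) : Prop :=
  exists p : nat, prime p /\ (A #= `I_p)%card.

Definition supersoluble_factor : factor_condition := fun Q A =>
  (A `<=` socle Q /\ infinite_cyclic A) \/ prime_order A.

Section Series.
Variables (P : factor_condition) (B : skewBraceType).

Definition series_step (I J : ideal B) : Prop :=
  I `<=` J /\ P (factor I J).

(* s 0, ..., s n is a series of ideals from {0} to B whose factors satisfy P;
   the values of s beyond n are irrelevant. *)
Definition finite_series (n : nat) (s : nat -> ideal B) : Prop :=
  [/\ s 0%N = [set 0] :> set B,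
      s n = [set: B] :> set B
    & forall i : nat, (i < n)%N -> series_step (s i) (s i.+1)].

Section Ascending.
Variables (W : Type) (R : rel W).

Definition wo_first (x : W) : Prop := forall y, R x y.

Definition wo_lt (x y : W) : Prop := R x y /\ x <> y.

Definition wo_succ (x y : W) : Prop :=
  wo_lt x y /\ forall z, wo_lt x z -> R y z.

Definition wo_limit (x : W) : Prop :=
  ~ wo_first x /\ ~ (exists y, wo_succ y x).

Definition ascending_series (s : W -> ideal B) : Prop :=
  [/\ forall x, wo_first x -> s x = [set 0] :> set B,
      forall x y, wo_succ x y -> series_step (s x) (s y)
    & forall x, wo_limit x ->
        s x = \bigcup_(y in [set y | wo_lt y x]) (s y : set B) :> set B].

End Ascending.

Definition has_finite_series : Prop :=
  exists (n : nat) (s : nat -> ideal B), finite_series n s.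

(* The well-ordered set (W,R) with last element [alpha] represents the set of
   the ordinals up to and including an ordinal; R is the non-strict order. *)
Definition has_ascending_series : Prop :=
  exists (W : Type) (R : rel W) (alpha : W) (s : W -> ideal B),
    [/\ well_order R, forall x, R x alpha, ascending_series R s
      & s alpha = [set: B] :> set B].

End Series.

(* For [is_centre] (resp. [is_socle]) the conditions on the series are the
   defining equations of Z_alpha(B) (resp. Soc_alpha(B)): the step condition
   reads Z_(alpha+1)(B)/Z_alpha(B) = Z(B/Z_alpha(B)).  They determine the
   series, so the existence of a series ending with B means B = Z_alpha(B)
   (resp. B = Soc_alpha(B)) for the index alpha of its last term. *)
Definition centrally_nilpotent (B : skewBraceType) : Prop :=
  has_finite_series is_centre B.

Definition hypercentral (B : skewBraceType) : Prop :=
  has_ascending_series is_centre B.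

Definition hypermultipermutational (B : skewBraceType) : Prop :=
  has_ascending_series is_socle B.

Definition locally_finite (B : skewBraceType) : Prop :=
  forall S : set B, sub_skew_brace S -> finitely_generated S -> finite_set S.

Definition soluble (B : skewBraceType) : Prop :=
  has_finite_series abelian_factor B.

Definition almost_polycyclic (B : skewBraceType) : Prop :=
  has_finite_series polycyclic_factor B.

Definition supersoluble (B : skewBraceType) : Prop :=
  has_finite_series supersoluble_factor B.

Definition hypercyclic (B : skewBraceType) : Prop :=
  has_ascending_series supersoluble_factor B.

(* Main.v *)
From HB Require Import structures.
From mathcomp Require Import all_boot all_fingroup all_solvable.
From mathcomp Require Import all_classical wochoice finmap.
Require Import Defs.

(** Say that [a] is self-fixed modulo an ideal [I] when [a ∘ a] and [a + a] agree
modulo [I], i.e. [- a + lambda a a] lies in [I].  The cyclic additive group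
generated by [a] in [B/I] is then a sub-skew brace on which the two operations
coincide ([cyc_sub_skew_brace]).  The proof studies the skew braces all of
whose nonzero quotients contain a nonzero self-fixed element
([selffixed_rich]).

All the conditions of the theorem imply this property.  If a series of ideals
reaches [B] and [I] is proper, there is a first term outside [I]; it is the
successor of a term inside [I], and the factor between them provides the
element.  In abelian factors and in factors inside the socle every element is
self-fixed.  For finite factors one needs a fact about finite skew braces
([finite_selffix]): for each prime [q] dividing its order, a finite skew brace
has a nonzero self-fixed element of [q]-power additive order.  Indeed its left
translations for [∘] and right translations for [+] generate a permutation
group; after conjugation, a Sylow [q]-subgroup of that group has an orbit
containing 0 which is a Sylow [q]-subgroup of both groups of the brace, and a
[q]-group acting on a [q]-group has a nonzero fixed point.

The heart is that in a Dedekind skew brace with this property every self-fixed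
[c] of prime order [p] is central ([prime_selffix_central]).  Modulo a
sub-skew brace maximal among those avoiding [c], every nonzero sub-skew brace
contains [c].  In that situation the union [R] of the finite sub-skew braces
is everything ([monolith_finite_part]).  Otherwise some [a] outside [R] is
self-fixed modulo a finite ideal.  If a positive multiple of [a] is in [R],
then [a] generates a finite sub-skew brace together with a finite ideal.  If
not, [a] has a finite orbit under [lambda a], so that some power of [a] is
self-fixed; it has infinite order, and the infinite cyclic group that it
generates cannot contain [c].  Hence each [b] lies in a finite sub-skew brace,
whose order is a power of [p]: for a prime divisor [q], the self-fixed element
of [q]-power order has [c] among its multiples.  So [b] acts on the ideal of
order [p] generated by [c] by automorphisms of [p]-power order, and these are
trivial as the automorphism group has order [p - 1].

If a self-fixed [c] has infinite order, it is central modulo [p c] for each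
prime [p], and the subgroups generated by the [p c] intersect trivially
([infinite_selffix_central]).  Consequently an element that is self-fixed
modulo [I] is reached after finitely many steps of the upper central series
starting at [I] ([selffix_reached]).  This series cannot stop before [B], so
[B] is hypercentral; and each factor of an almost polycyclic series is
absorbed in finitely many steps, so that [B] is then centrally nilpotent. *)

Set Implicit Arguments.
Unset Strict Implicit.
Unset Printing Implicit Defensive.
Local Open Scope group_scope.
Local Open Scope classical_set_scope.
Open Scope brace_scope.

(** * Multiples and the lambda action *)

Section Elementary.
Variable B : skewBraceType.
Implicit Types a b c x y : B.

Lemma gaddIr a b c : b + a = c + a -> b = c.
Proof. by move=> /(congr1 (fun x => x - a)); rewrite -!gaddA gaddNr !gaddr0. Qed.

Lemma gopp0 : - (0 : B) = 0.
Proof. by rewrite -[LHS]gaddr0 gaddN. Qed.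

Lemma lambda0 a : lambda a 0 = 0.
Proof. by rewrite /lambda gmul0 gaddN. Qed.

Lemma lambda0l a : lambda 0 a = a.
Proof. by rewrite -brace1E lambda1. Qed.

Definition nmul n a : B := iter n (fun x => a + x) 0.

Lemma nmulS n a : nmul n.+1 a = a + nmul n a.
Proof. by []. Qed.

Lemma nmul1 a : nmul 1 a = a.
Proof. by rewrite nmulS gaddr0. Qed.

Lemma nmul0 n : nmul n 0 = 0.
Proof. by elim: n => // n IH; rewrite nmulS gadd0. Qed.

Lemma nmulD m n a : nmul (m + n)%N a = nmul m a + nmul n a.
Proof. by elim: m => [|m IH]; rewrite ?gadd0 // addSn !nmulS IH gaddA. Qed.

Lemma nmulM m n a : nmul (m * n)%N a = nmul m (nmul n a).
Proof. by elim: m => // m IH; rewrite mulSn nmulD nmulS IH. Qed.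

Lemma nmulC m n a : nmul m (nmul n a) = nmul n (nmul m a).
Proof. by rewrite -!nmulM mulnC. Qed.

Lemma nmulSr n a : nmul n.+1 a = nmul n a + a.
Proof. by rewrite -addn1 nmulD nmul1. Qed.

Lemma lambda_nmul a n b : lambda a (nmul n b) = nmul n (lambda a b).
Proof. by elim: n => [|n IH]; rewrite ?lambda0 // !nmulS lambdaD IH. Qed.

Lemma lambdaVK a : cancel (lambda a) (lambda a^-1%g).
Proof. by move=> x; rewrite -lambdaM mulVg lambda1. Qed.

Lemma lambdaI a : injective (lambda a).
Proof. exact: can_inj (lambdaVK a). Qed.
End Elementary.

(** * Cyclic trivial sub-skew braces *)

Section Cyclic.
Variable B : skewBraceType.
Implicit Types (a b c x y : B) (S I : set B).

Definition cyc a : set B := smallest (@add_subgroup B) [set a].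

Lemma cyc_id a : cyc a a.
Proof. by move=> S [_]; apply. Qed.
Arguments cyc_id : clear implicits.

Lemma cyc_add_subgroup a : add_subgroup (cyc a).
Proof.
split=> [S [[]] //|x y ax ay S|x ax S]; case=> subS aS.
  by have [_ SD _] := subS; apply: SD; [apply: ax|apply: ay].
by have [_ _ SN] := subS; apply: SN; apply: ax.
Qed.

Lemma cyc_sub a S : add_subgroup S -> S a -> cyc a `<=` S.
Proof. by move=> subS Sa; apply: smallest_sub => // _ ->. Qed.

Lemma cycP a x : cyc a x -> exists n, x = nmul n a \/ x = - nmul n a.
Proof.
apply: (cyc_sub (S := [set x | exists n, x = nmul n a \/ x = - nmul n a])).
  split; first by exists 0%N; left.
  - have addS m n : exists k,
        nmul m a - nmul n a = nmul k a \/ nmul m a - nmul n a = - nmul k a.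
      have [le|/ltnW le] := leqP n m; [exists (m - n)%N; left|exists (n - m)%N; right].
        by rewrite -{1}(subnK le) nmulD -gaddA gaddNr gaddr0.
      by rewrite -{1}(subnK le) nmulD goppD gaddA gaddNr gadd0.
    have addS' m n : exists k,
        - nmul n a + nmul m a = nmul k a \/ - nmul n a + nmul m a = - nmul k a.
      have [le|/ltnW le] := leqP n m; [exists (m - n)%N; left|exists (n - m)%N; right].
        by rewrite -{1}(subnKC le) nmulD gaddKN.
      by rewrite -{1}(subnKC le) nmulD goppD -gaddA gaddN gaddr0.
    move=> _ _ [m [->|->]] [n [->|->]].
    - by exists (m + n)%N; left; rewrite nmulD.
    - exact: addS.
    - exact: addS'.
    by exists (n + m)%N; right; rewrite nmulD goppD.
  - by move=> _ [m [->|->]]; exists m; [right|left; rewrite gopp_K].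
by exists 1%N; left; rewrite nmul1.
Qed.

(** When the order is finite, negative multiples are also positive ones. *)
Lemma cycP_fin a n x : (0 < n)%N -> nmul n a = 0 -> cyc a x ->
  exists m, x = nmul m a.
Proof.
move=> n0 na0 /cycP[m [->|->]]; first by exists m.
exists (m * n.-1)%N; apply: (@gaddI _ (nmul m a)).
by rewrite -nmulD gaddNr -mulnS prednK // nmulM na0 nmul0.
Qed.

Lemma nmul_sub S n a : add_subgroup S -> S a -> S (nmul n a).
Proof. by case=> S0 SD _ Sa; elim: n => // n IH; rewrite nmulS; apply: SD. Qed.

Lemma cyc_nmul n a : cyc a (nmul n a).
Proof. exact: (nmul_sub n (cyc_add_subgroup a) (cyc_id a)). Qed.
Arguments cyc_nmul : clear implicits.

Lemma nmulN n a : nmul n (- a) = - nmul n a.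
Proof. by elim: n => [|n IH]; rewrite ?gopp0 // nmulS IH -goppD -nmulSr. Qed.

Section Selffix.
Variables (a : B).
Hypothesis aa : lambda a a = a.

(** The elements fixed by [lambda a] form an additive subgroup, and so do the
elements of [cyc a] acting trivially on [cyc a], because [u + v = u ∘ v] as soon
as [lambda u] fixes [v]. *)
Lemma cyc_lambda x y : cyc a x -> cyc a y -> lambda x y = y.
Proof.
have fixS b : add_subgroup [set y | lambda b y = y].
  split=> [|u v /= bu bv|u /= bu]; first exact: lambda0.
    by rewrite lambdaD bu bv.
  by rewrite lambdaN bu.
suff : cyc a `<=` [set x | cyc a x /\ (forall y, cyc a y -> lambda x y = y)].
  by move=> H /H[_]; apply.
have [a0 aD aN] := cyc_add_subgroup a.
apply: cyc_sub => [|/=]; last by split; [apply: cyc_id | apply: (cyc_sub (fixS a))].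
split=> /=; first by split=> // z _; rewrite lambda0l.
  move=> u v [au fu] [av fv]; split=> [|z az]; first exact: aD.
  by rewrite -{1}(fu v av) -gmulE lambdaM fv ?fu.
move=> u [au fu]; split=> [|z az]; first exact: aN.
have -> : - u = u^-1%g.
  apply: (mulgI u); rewrite gmulE lambdaN fu //.
  by rewrite gaddNr mulgV brace1E.
by apply: (@lambdaI _ u); rewrite -lambdaM mulgV lambda1 fu.
Qed.

Lemma cyc_circ x y : cyc a x -> cyc a y -> x ∘ y = x + y.
Proof. by move=> ax ay; rewrite gmulE cyc_lambda. Qed.

Lemma cyc_inv x : cyc a x -> x^-1%g = - x.
Proof.
have [_ _ aN] := cyc_add_subgroup a.
move=> ax; apply: (mulgI x); rewrite (cyc_circ ax (aN _ ax)).
by rewrite gaddNr mulgV brace1E.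
Qed.

Lemma cyc_sub_skew_brace : sub_skew_brace (cyc a).
Proof.
have subA := cyc_add_subgroup a; have [a0 aD aN] := subA.
split=> //; split=> [|x y ax ay|x ax]; first by rewrite brace1E.
  by rewrite cyc_circ //; apply: aD.
by rewrite cyc_inv //; apply: aN.
Qed.

Lemma cyc_expg n : (a ^+ n)%g = nmul n a.
Proof.
elim: n => [|n IH]; first by rewrite expg0 brace1E.
rewrite expgS IH.
by rewrite (cyc_circ (cyc_id a) (cyc_nmul n a)).
Qed.
End Selffix.
End Cyclic.
Arguments cyc_id {B} a.
Arguments cyc_nmul {B} n a.

(** * Self-fixed elements of finite skew braces *)

#[short(type="finSkewBraceType")]
HB.structure Definition FinSkewBrace := {B of SkewBrace B & Finite B}.

(** Finite sub-skew braces are turned into finite types so that the Sylow theorems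
for permutation groups apply to them. *)
Record finSubBrace (B : skewBraceType) := FinSubBrace {
  fsb_fset :> {fset B};
  fsb_subP : sub_skew_brace [set` fsb_fset]
}.

Section FinSub.
Variables (B : skewBraceType) (K : finSubBrace B).

Definition fsb_sort : Type := fset_sub_type (fsb_fset K).
HB.instance Definition _ := Choice.on fsb_sort.
HB.instance Definition _ := Finite.on fsb_sort.

Let K0 : (0 : B) \in fsb_fset K. Proof. by case: (fsb_subP K) => [[]]. Qed.
Let KD (x y : fsb_sort) : val x + val y \in fsb_fset K.
Proof. by case: (fsb_subP K) => [[_ + _] _]; apply; apply: valP. Qed.
Let KN (x : fsb_sort) : - val x \in fsb_fset K.
Proof. by case: (fsb_subP K) => [[_ _ +] _]; apply; apply: valP. Qed.
Let K1 : (1%g : B) \in fsb_fset K. Proof. by case: (fsb_subP K) => [_ []]. Qed.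
Let KM (x y : fsb_sort) : val x ∘ val y \in fsb_fset K.
Proof. by case: (fsb_subP K) => [_ [_ + _]]; apply; apply: valP. Qed.
Let KV (x : fsb_sort) : (val x)^-1%g \in fsb_fset K.
Proof. by case: (fsb_subP K) => [_ [_ _ +]]; apply; apply: valP. Qed.

Definition fsb_zero : fsb_sort := FSetSub K0.
Definition fsb_add (x y : fsb_sort) : fsb_sort := FSetSub (KD x y).
Definition fsb_opp (x : fsb_sort) : fsb_sort := FSetSub (KN x).
Definition fsb_one : fsb_sort := FSetSub K1.
Definition fsb_mul (x y : fsb_sort) : fsb_sort := FSetSub (KM x y).
Definition fsb_inv (x : fsb_sort) : fsb_sort := FSetSub (KV x).

Fact fsb_addA x y z : fsb_add x (fsb_add y z) = fsb_add (fsb_add x y) z.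
Proof. by apply: val_inj; rewrite /= gaddA. Qed.
Fact fsb_add0 x : fsb_add fsb_zero x = x.
Proof. by apply: val_inj; rewrite /= gadd0. Qed.
Fact fsb_addN x : fsb_add (fsb_opp x) x = fsb_zero.
Proof. by apply: val_inj; rewrite /= gaddN. Qed.
HB.instance Definition _ := isAddGroup.Build fsb_sort fsb_addA fsb_add0 fsb_addN.

Fact fsb_mulA x y z : fsb_mul x (fsb_mul y z) = fsb_mul (fsb_mul x y) z.
Proof. by apply: val_inj; rewrite /= mulgA. Qed.
Fact fsb_mul1 x : fsb_mul fsb_one x = x.
Proof. by apply: val_inj; rewrite /= mul1g. Qed.
Fact fsb_1mul x : fsb_mul x fsb_one = x.
Proof. by apply: val_inj; rewrite /= mulg1. Qed.
Fact fsb_mulV x : fsb_mul (fsb_inv x) x = fsb_one.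
Proof. by apply: val_inj; rewrite /= mulVg. Qed.
Fact fsb_Vmul x : fsb_mul x (fsb_inv x) = fsb_one.
Proof. by apply: val_inj; rewrite /= mulgV. Qed.
HB.instance Definition _ :=
  isGroup.Build fsb_sort fsb_mulA fsb_mul1 fsb_1mul fsb_mulV fsb_Vmul.

Fact fsb_mulD (x y z : fsb_sort) : x ∘ (y + z) = x ∘ y - x + x ∘ z.
Proof. by apply: val_inj; rewrite /= gmulD. Qed.
HB.instance Definition _ := isSkewBrace.Build fsb_sort fsb_mulD.

Definition fsb_brace : finSkewBraceType := fsb_sort.
End FinSub.

Section Sylow.
Variables (T : finSkewBraceType) (q : nat).
Hypotheses (q_pr : prime q) (q_dvd : (q %| #|T|)%N).
Implicit Types u g x : T.

Lemma radd_inj u : injective (fun x => x + u).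
Proof. by move=> x y; apply: gaddIr. Qed.
Lemma lmul_inj g : injective (fun x => g ∘ x).
Proof. exact: mulgI. Qed.
Definition radd u : {perm T} := perm (@radd_inj u).
Definition lmul g : {perm T} := perm (@lmul_inj g).

Lemma raddE u x : radd u x = x + u. Proof. by rewrite permE. Qed.
Lemma lmulE g x : lmul g x = g ∘ x. Proof. by rewrite permE. Qed.
Lemma radd_0 u : radd u 0 = u. Proof. by rewrite raddE gadd0. Qed.
Lemma lmul_0 g : lmul g 0 = g. Proof. by rewrite lmulE gmul0. Qed.

Lemma raddD u v : radd (u + v) = (radd u * radd v)%g.
Proof. by apply/permP => x; rewrite permM !raddE gaddA. Qed.
Lemma lmulM g h : lmul (g ∘ h) = (lmul h * lmul g)%g.
Proof. by apply/permP => x; rewrite permM !lmulE mulgA. Qed.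

Lemma radd_nmul n u : radd (nmul n u) = (radd u ^+ n)%g.
Proof.
elim: n => [|n IH]; last by rewrite nmulS raddD IH expgS.
by apply/permP => y; rewrite raddE gaddr0 perm1.
Qed.

Lemma radd_is_inj : injective radd.
Proof. by move=> u v /(congr1 (fun p : {perm T} => p 0)); rewrite !radd_0. Qed.
Lemma lmul_is_inj : injective lmul.
Proof. by move=> u v /(congr1 (fun p : {perm T} => p 0)); rewrite !lmul_0. Qed.

Lemma radd_group_set : group_set (radd @: [set: T])%SET.
Proof.
apply/group_setP; split.
  by apply/imsetP; exists 0 => //; apply/permP => x; rewrite raddE perm1 gaddr0.
by move=> _ _ /imsetP[u _ ->] /imsetP[v _ ->]; rewrite -raddD; apply: imset_f.
Qed.
Lemma lmul_group_set : group_set (lmul @: [set: T])%SET.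
Proof.
apply/group_setP; split.
  by apply/imsetP; exists 1%g => //; apply/permP => x; rewrite lmulE perm1 mul1g.
by move=> _ _ /imsetP[u _ ->] /imsetP[v _ ->]; rewrite -lmulM; apply: imset_f.
Qed.
Definition raddG := Group radd_group_set.
Definition lmulG := Group lmul_group_set.
Lemma nmul_card u : nmul #|T| u = 0.
Proof.
rewrite -(radd_0 (nmul _ _)) radd_nmul -cardsT.
have -> : #|[set: T]%SET| = #|raddG|.
  by rewrite card_imset ?cardsT //; apply: radd_is_inj.
by rewrite expg_cardG ?perm1 // imset_f.
Qed.

(** The group of the maps [x |-> g ∘ x + u], an image of the semidirect product of
the two groups of the brace. *)
Definition affG := (raddG <*> lmulG)%G.

Lemma card_raddG : #|raddG| = #|T|.
Proof. by rewrite card_imset ?cardsT //; apply: radd_is_inj. Qed.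
Lemma card_lmulG : #|lmulG| = #|T|.
Proof. by rewrite card_imset ?cardsT //; apply: lmul_is_inj. Qed.

(** The additive translations are normalised by the multiplicative ones, and
conjugation induces [lambda]; this is where the skew brace axiom enters. *)
Lemma radd_lmul u g : (radd u ^ lmul g)%g = radd (lambda g u).
Proof.
apply: (mulgI (lmul g)); rewrite conjgE mulVKg.
apply/permP => x; rewrite !permM !raddE !lmulE.
by rewrite gmulD /lambda -gaddA.
Qed.

Lemma raddG_normal : raddG <| affG.
Proof.
rewrite /normal joing_subl join_subG normG; apply/fintype.subsetP => _ /imsetP[g _ ->].
rewrite inE; apply/fintype.subsetP => _ /imsetP[_ /imsetP[u _ ->] ->].
by rewrite radd_lmul imset_f.
Qed.

Let a := logn q #|T|.

Lemma mem_orbitP (Q : {group {perm T}}) x y :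
  reflect (exists2 p, p \in Q & p x = y) (y \in orbit 'P Q x).
Proof. by apply: (iffP orbitP) => -[p Qp <-]; exists p. Qed.

Lemma orbit_permJ (Q : {group {perm T}}) (p : {perm T}) y z :
  (p y \in orbit 'P (Q :^ p) (p z)) = (y \in orbit 'P Q z).
Proof. exact: (orbit_conjsg 'P Q p z y). Qed.

(** The additive translations form a normal subgroup, so they meet any Sylow
subgroup in a Sylow subgroup. *)
Lemma card_radd_mem (Q : {group {perm T}}) : q.-Sylow(affG) Q ->
  #|[set u | radd u \in Q]%SET| = (q ^ a)%N.
Proof.
move=> sylQ; have := card_Hall (Sylow_setI_normal raddG_normal sylQ).
rewrite card_raddG p_part -/a => <-.
rewrite -(card_imset _ radd_is_inj); apply: eq_card => p; rewrite inE.
apply/imsetP/andP => [[u]|[/imsetP[u _ ->] Qu]]; last by exists u; rewrite ?inE.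
by rewrite inE => Qu ->; rewrite imset_f.
Qed.

(** Every orbit has [q]-power size, at least [q ^ a] since [q ^ a] additive
translations act freely on it.  The orbits cannot all have size divisible by
[q ^ a.+1], as this number does not divide the order of the brace. *)
Lemma small_orbit (Q : {group {perm T}}) : q.-Sylow(affG) Q ->
  exists x, #|orbit 'P Q x| = (q ^ a)%N.
Proof.
move=> sylQ; apply/not_existsP => large.
have qQ := pHall_pgroup sylQ.
have big x : (q ^ a.+1 %| #|orbit 'P Q x|)%N.
  have : (#|orbit 'P Q x| %| q ^ logn q #|Q|)%N.
    by rewrite -card_pgroup // dvdn_orbit.
  case/(dvdn_pfactor _ _ q_pr) => j _ orbE; rewrite orbE dvdn_exp2l //.
  rewrite ltnNge; apply/negP => lej; apply: (large x).
  apply/eqP; rewrite eqn_leq {1}orbE leq_exp2l ?prime_gt1 // lej /=.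
  rewrite -(card_radd_mem sylQ) -(card_imset _ (can_inj (gaddKN x))).
  apply/subset_leq_card/fintype.subsetP => _ /imsetP[u Qu ->].
  move: Qu; rewrite inE => Qu.
  by apply/mem_orbitP; exists (radd u); rewrite ?raddE.
have actT : [acts Q, on [set: T]%SET | 'P].
  apply/fintype.subsetP => p _; rewrite !inE.
  by apply/fintype.subsetP => y _; rewrite !inE.
have := acts_sum_card_orbit actT; rewrite cardsT => cardT.
have : (q ^ a.+1 %| #|T|)%N.
  by rewrite -cardT; apply: dvdn_sum => O /imsetP[x _ ->].
rewrite pfactor_dvdn ?ltnn // -cardsT; apply/card_gt0P.
by exists 0; rewrite inE.
Qed.

(** Multiplicative translations do not form a normal subgroup: the Sylow subgroup is
chosen to contain a Sylow subgroup of them, and then conjugated by a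
translation moving a small orbit to one through 0. *)
Lemma Sylow_zero_orbit : exists Q : {group {perm T}},
  [/\ q.-Sylow(affG) Q, #|orbit 'P Q 0| = (q ^ a)%N
    & #|[set g | lmul g \in Q]%SET| = (q ^ a)%N].
Proof.
have [P sylP] := Sylow_exists q lmulG.
have sPaff : P \subset affG.
  by rewrite (fintype.subset_trans (pHall_sub sylP)) ?joing_subr.
have [Q sylQ sPQ] := Sylow_superset sPaff (pHall_pgroup sylP).
have [x orbx] := small_orbit sylQ.
have affx : (lmul x)^-1%g \in affG.
  by rewrite groupV (fintype.subsetP (joing_subr _ _)) // imset_f.
exists (Q :^ (lmul x)^-1)%G; split; first by rewrite pHallJ.
  rewrite -orbx -[RHS](card_imset _ (@perm_inj _ (lmul x)^-1%g)).
  have E : (lmul x)^-1%g x = 0 by rewrite -{2}[x]lmul_0 permK.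
  have E2 z : ((lmul x)^-1%g z \in orbit 'P (Q :^ (lmul x)^-1)%G 0) =
      (z \in orbit 'P Q x).
    by rewrite -{1}E; exact: orbit_permJ.
  apply: eq_card => y; apply/idP/imsetP => [oy|[z zx ->]].
    exists (lmul x y); last by rewrite permK.
    by have := E2 (lmul x y); rewrite permK => oyE; exact: etrans (esym oyE) oy.
  exact: etrans (E2 z) zx.
have sPlmul := pHall_sub sylP.
have cardP : #|P| = (q ^ a)%N by rewrite (card_Hall sylP) card_lmulG p_part.
have Pmem p : (p \in P :^ (lmul x)^-1)%g =
    (p \in lmulG) && (p \in Q :^ (lmul x)^-1)%g.
  suff -> : P :=: lmulG :&: Q.
    by rewrite conjIg inE conjGid // groupV imset_f.
  apply/esym/(sub_pHall sylP).
  - by rewrite (pgroupS (finset.subsetIr _ _)) ?(pHall_pgroup sylQ).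
  - by rewrite finset.subsetI sPlmul.
  - exact: finset.subsetIl.
rewrite -cardP -(cardJg _ (lmul x)^-1) -(card_imset _ lmul_is_inj).
apply: eq_card => p; rewrite Pmem; apply/imsetP/andP.
  by case=> g; rewrite inE => Qg ->; rewrite imset_f.
by case=> /imsetP[g _ ->] Qg; exists g; rewrite ?inE.
Qed.

(** On the translation by [g] this is [lambda g x], read off from the permutation.
Using permutations as the acting group makes its Sylow theory available. *)
Definition rel_act (x : T) (p : {perm T}) : T := - (p 0) + p x.

Lemma rel_act_is_action : is_action lmulG rel_act.
Proof.
split=> [p x y|x _ _ /imsetP[g _ ->] /imsetP[h _ ->]].
  by move/gaddI/perm_inj.
by rewrite -lmulM /rel_act !lmulE !gmul0; apply: lambdaM.
Qed.
Definition lambda_act := Action rel_act_is_action.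

(** With [Q] as in [Sylow_zero_orbit], counting shows that the orbit of 0 consists
of the [u] with [radd u \in Q] and also of the [g] with [lmul g \in Q].  It is
thus closed under both operations, and its multiplicative group is a [q]-group
acting on it by [lambda].  The number of fixed points is divisible by [q], and 0
is one of them; a nonzero fixed point is in particular fixed by its own
[lambda]. *)
Lemma finite_selffix : exists x k, [/\ x != 0 :> T, lambda x x = x & nmul (q ^ k) x = 0].
Proof.
have [Q [sylQ card0 cardl]] := Sylow_zero_orbit.
have raddS x : (x \in orbit 'P Q 0) = (radd x \in Q).
  transitivity (x \in [set u | radd u \in Q]%SET); last by rewrite inE.
  have /eqP-> : [set u | radd u \in Q]%SET == orbit 'P Q 0; last by [].
  rewrite eqEcard card0 card_radd_mem // leqnn andbT.
  apply/fintype.subsetP => u; rewrite inE => Qu; apply/mem_orbitP.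
  by exists (radd u); rewrite ?radd_0.
have lmulS x : (x \in orbit 'P Q 0) = (lmul x \in Q).
  transitivity (x \in [set u | lmul u \in Q]%SET); last by rewrite inE.
  have /eqP-> : [set u | lmul u \in Q]%SET == orbit 'P Q 0; last by [].
  rewrite eqEcard card0 cardl leqnn andbT.
  apply/fintype.subsetP => u; rewrite inE => Qu; apply/mem_orbitP.
  by exists (lmul u); rewrite ?lmul_0.
have qQ := pHall_pgroup sylQ.
pose H := (lmulG :&: Q)%G.
have actH : [acts H, on orbit 'P Q 0 | lambda_act].
  apply/fintype.subsetP => p /setIP[Gp Qp]; rewrite inE Gp /= inE.
  apply/fintype.subsetP => x Sx; rewrite inE /= /rel_act raddS.
  have [g _ pE] := imsetP Gp; move: Qp; rewrite {p Gp}pE -lmulS => Sg.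
  rewrite raddD groupM //.
    have -> : radd (- lmul g 0) = (radd g)^-1%g.
      apply/esym/eqP; rewrite eq_invg_mul -raddD lmul_0 gaddNr.
      by apply/eqP/permP => y; rewrite raddE gaddr0 perm1.
    by rewrite groupV -raddS.
  rewrite -raddS; apply/mem_orbitP; exists (radd x * lmul g)%g.
    by rewrite groupM // -?raddS -?lmulS.
  by rewrite permM radd_0.
have := pgroup_fix_mod (pgroupS (finset.subsetIr _ _) qQ : q.-group H) actH.
rewrite card0 => modE.
have a_gt0 : (0 < a)%N.
  rewrite logn_gt0 mem_primes q_pr q_dvd andbT -cardsT; apply/card_gt0P.
  by exists 0; rewrite inE.
pose F := 'Fix_(orbit 'P Q 0 | lambda_act)(H).
(* The orbit has size [q ^ a] with [a > 0]. *)
have dvdFix : (q %| #|F|)%N by rewrite /dvdn -modE -/(dvdn _ _) dvdn_exp.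
have F0 : 0 \in F.
  rewrite inE orbit_refl; apply/afixP => p _; by rewrite /= /rel_act gaddN.
have /card_gt1P[x [y [Fx Fy neq_xy]]] : (1 < #|F|)%N.
  by apply: leq_trans (prime_gt1 q_pr) (dvdn_leq _ dvdFix); apply/card_gt0P; exists 0.
have {x y Fx Fy neq_xy}[x Fx x0] : exists2 x, x \in F & x != 0.
  have [x0|] := eqVneq x 0; last by exists x.
  by exists y; rewrite // -x0 eq_sym.
move: Fx; rewrite inE => /andP[Sx /afixP fixx].
exists x, (logn q #|Q|); split => //.
  have := fixx (lmul x); rewrite /= /rel_act lmul_0 lmulE; apply.
  by rewrite inE imset_f // -lmulS.
rewrite -card_pgroup // -(radd_0 (nmul _ _)) radd_nmul expg_cardG ?perm1 //.
by rewrite -raddS.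
Qed.
End Sylow.

Section FiniteSub.
Variables (B : skewBraceType) (S : set B).
Hypotheses (subS : sub_skew_brace S) (finS : finite_set S).

(** The number [n] is the common order of the two groups. *)
Lemma finite_sub_order : exists n : nat, [/\ (0 < n)%N,
  forall b, S b -> nmul n b = 0 /\ (b ^+ n)%g = 1%g,
  (n = 1)%N -> S `<=` [set 0]
  & forall q, prime q -> (q %| n)%N ->
      exists x k, [/\ S x, x <> 0, lambda x x = x & nmul (q ^ k)%N x = 0]].
Proof.
have SE : [set` fset_set S] = S by rewrite fset_setK.
have memS x : (x \in fset_set S) -> S x by rewrite in_fset_set // => /set_mem.
have subK : sub_skew_brace [set` fset_set S] by rewrite SE.
pose T := fsb_brace (FinSubBrace subK).
have val_nmul n (x : T) : val (nmul n x) = nmul n (val x).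
  by elim: n => [//|n IH]; rewrite !nmulS -IH.
have val_X n (x : T) : val (x ^+ n)%g = (val x ^+ n)%g.
  by elim: n => [//|n IH]; rewrite !expgS -IH.
exists #|T|; split.
- by rewrite -cardsT; apply/card_gt0P; exists 0; rewrite inE.
- move=> b Sb; have bK : b \in fset_set S by rewrite in_fset_set // mem_set.
  pose x : T := FSetSub bK; have -> : b = val x by [].
  rewrite -val_nmul -val_X nmul_card; split=> //.
  by rewrite -cardsT expg_cardG ?inE.
- move=> T1 b Sb; have bK : b \in fset_set S by rewrite in_fset_set // mem_set.
  have : nmul #|T| (FSetSub bK : T) = 0 := nmul_card _.
  by rewrite T1 nmul1 => /(congr1 val).
move=> q q_pr q_dvd; have [x [k [x0 xx kx]]] := @finite_selffix T q q_pr q_dvd.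
exists (val x), k; split.
- exact/memS/(valP x).
- by move=> x0'; case/eqP: x0; apply: val_inj.
- by rewrite -{3}xx.
- by rewrite -val_nmul kx.
Qed.

Lemma finite_sub_selffix : ~ S `<=` [set 0] ->
  exists x, [/\ S x, x <> 0 & lambda x x = x].
Proof.
have [n [n0 _ n1 nq]] := finite_sub_order => S0.
have n_neq1 : n != 1%N by apply/eqP => /n1.
have n_gt1 : (1 < n)%N by rewrite ltn_neqAle eq_sym n_neq1.
have [x [k [Sx x0 xx _]]] := nq _ (pdiv_prime n_gt1) (pdiv_dvd n).
by exists x.
Qed.
End FiniteSub.

(** * Quotients and relative centres *)

Section QuotientMorphism.
Variables (B : skewBraceType) (I : ideal B).
Local Notation pi := (quot_pi I).
Implicit Types x y : B.

Lemma piD x y : pi (x + y) = pi x + pi y.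
Proof. exact: quot_piD. Qed.
Lemma piN x : pi (- x) = - pi x.
Proof. exact: quot_piN. Qed.
Lemma piM x y : pi (x ∘ y) = pi x ∘ pi y.
Proof. exact: quot_piM. Qed.
Lemma piV x : pi x^-1%g = (pi x)^-1%g.
Proof. exact: quot_piV. Qed.
Lemma pi0 : pi 0 = 0. Proof. by []. Qed.

Lemma pi_lambda x y : pi (lambda x y) = lambda (pi x) (pi y).
Proof. by rewrite /lambda piD piN piM. Qed.
Lemma pi_nmul n x : pi (nmul n x) = nmul n (pi x).
Proof. by elim: n => // n IH; rewrite !nmulS piD IH. Qed.

Lemma pi_eq x y : ideal_set I (- x + y) <-> pi x = pi y.
Proof. by have [pq qp] := quotP I x y; split. Qed.
Lemma pi_eq0 x : ideal_set I x <-> pi x = 0.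
Proof.
rewrite -pi0; split=> [Ix|/esym/quotP]; last by rewrite gopp0 gadd0.
by apply/esym/quotP; rewrite gopp0 gadd0.
Qed.

Lemma pi_surj (y : quot I) : exists x, y = pi x.
Proof. by elim/quot_ind: y => x; exists x. Qed.

Lemma ideal_sub_skew_brace : sub_skew_brace I.
Proof. by case: (ideal_isP I) => [[? _] _ [? _]]. Qed.

Lemma preim_sub_skew_brace (S : set (quot I)) :
  sub_skew_brace S -> sub_skew_brace (pi @^-1` S).
Proof.
move=> [[S0 SD SN] [S1 SM SV]]; split; split=> //= [x y|x] *.
- by rewrite piD; apply: SD.
- by rewrite piN; apply: SN.
- by rewrite piM; apply: SM.
- by rewrite piV; apply: SV.
Qed.

Lemma factor_sub_skew_brace (S : set B) :
  sub_skew_brace S -> sub_skew_brace (factor I S).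
Proof.
move=> [[S0 SD SN] [S1 SM SV]]; split; split.
- by exists 0.
- by move=> _ _ [x Sx <-] [y Sy <-]; exists (x + y); [apply: SD|rewrite piD].
- by move=> _ [x Sx <-]; exists (- x); [apply: SN|rewrite piN].
- by exists 1%g.
- by move=> _ _ [x Sx <-] [y Sy <-]; exists (x ∘ y); [apply: SM|rewrite piM].
- by move=> _ [x Sx <-]; exists x^-1%g; [apply: SV|rewrite piV].
Qed.

Lemma factor_ideal (S : set B) : is_ideal S -> is_ideal (factor I S).
Proof.
move=> [[addS SA] SL [mulS SC]].
have [addF mulF] := factor_sub_skew_brace (conj addS mulS).
split; first (split=> // _ y [x Sx <-]); last (split=> // _ y [x Sx <-]).
- have [z ->] := pi_surj y; exists (z + x - z); first exact: SA.
  by rewrite !piD piN.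
- move=> b _ [x Sx <-]; have [z ->] := pi_surj b.
  by exists (lambda z x); [apply: SL|rewrite pi_lambda].
- have [z ->] := pi_surj y; exists (z ∘ x ∘ z^-1%g); first exact: SC.
  by rewrite !piM piV.
Qed.

Lemma factor_preim (S : set (quot I)) : factor I (pi @^-1` S) = S.
Proof.
apply/seteqP; split=> [_ [x Sx <-] //|y Sy].
by have [x yE] := pi_surj y; exists x; rewrite /preimage /= -?yE.
Qed.

Lemma dedekind_quot : dedekind B -> dedekind (quot I).
Proof.
move=> dedB S /preim_sub_skew_brace/dedB/factor_ideal.
by rewrite factor_preim.
Qed.

End QuotientMorphism.

Section RelativeCentre.
Variable B : skewBraceType.
Implicit Types (a b c x y : B) (S I : set B).

(** For an ideal [S] this is the preimage of the centre of [B/S] (see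
[rel_centre_quot]).  Stated by commutators it is defined for every set and
visibly monotone, which the transfinite construction below relies on. *)
Definition rel_centre S : set B := [set x | forall b,
  [/\ S (- b + lambda x b), S (- (b + x) + (x + b)) & S (- (b ∘ x) + x ∘ b)]].

Lemma rel_centre_mono S S' : S `<=` S' -> rel_centre S `<=` rel_centre S'.
Proof. by move=> sSS' x nx b; have [? ? ?] := nx b; split; apply: sSS'. Qed.

Lemma rel_centre_quot (I : ideal B) : rel_centre I = quot_pi I @^-1` centre (quot I).
Proof.
apply/seteqP; split=> x /=.
  move=> nx; do 2?split; move=> b; have [y ->] := pi_surj b;
    have [/pi_eq e1 /pi_eq e2 /pi_eq e3] := nx y.
  - by rewrite -pi_lambda e1.
  - by rewrite -!piD e2.
  - by rewrite -!piM e3.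
move=> [[cl ca] cm] b; split; apply/pi_eq.
- by rewrite pi_lambda cl.
- by rewrite !piD ca.
- by rewrite !piM cm.
Qed.

Lemma factor_rel_centre (I : ideal B) : factor I (rel_centre I) = centre (quot I).
Proof. by rewrite rel_centre_quot factor_preim. Qed.

Lemma centre_sub_skew_brace : sub_skew_brace (centre B).
Proof.
have centE a b : centre B a -> a ∘ b = a + b.
  by case=> [[la _] _]; rewrite gmulE la.
have c0 : centre B 0.
  do 2?split; move=> b; first exact: lambda0l.
    by rewrite gadd0 gaddr0.
  by rewrite -brace1E mul1g mulg1.
have cM a b : centre B a -> centre B b -> centre B (a ∘ b).
  move=> Za Zb; have abE := centE a b Za.
  case: Za Zb => [[la aa] ma] [[lb ab] mb].
  do 2?split; move=> x; first by rewrite lambdaM lb la.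
    by rewrite abE -gaddA ab gaddA aa -gaddA.
  rewrite -mulgA mb. by rewrite mulgA (ma x) mulgA.
have NE a : centre B a -> - a = a^-1%g.
  move=> Za; apply: (mulgI a); rewrite centE // gaddNr mulgV.
  by rewrite brace1E.
have cN a : centre B a -> centre B (- a).
  move=> Za; have aE := NE a Za; case: Za => [[la aa] ma].
  do 2?split; move=> x.
  - by rewrite aE; apply: (@lambdaI _ a); rewrite -lambdaM mulgV lambda1 la.
  - by apply: (@gaddI _ a); rewrite gadd_NK gaddA aa -gaddA gaddNr gaddr0.
  - by rewrite aE; apply: (mulgI a); rewrite mulVKg mulgA ma mulgK.
split; split=> //.
- by move=> a b Za Zb; rewrite -centE //; apply: cM.
- by rewrite brace1E.
- by move=> a Za; rewrite -NE //; apply: cN.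
Qed.

End RelativeCentre.

Section Dedekind.
Variable B : skewBraceType.
Implicit Types (a b c x y : B) (S I : set B).
Hypothesis dedB : dedekind B.

Definition mkideal S (subS : sub_skew_brace S) : ideal B := Ideal (dedB subS).

Lemma rel_centre_sub_skew_brace S : sub_skew_brace S -> sub_skew_brace (rel_centre S).
Proof.
move=> subS; rewrite (rel_centre_quot (mkideal subS)).
by apply: preim_sub_skew_brace; apply: centre_sub_skew_brace.
Qed.

Lemma sub_rel_centre S : sub_skew_brace S -> S `<=` rel_centre S.
Proof.
move=> subS x Sx; rewrite (rel_centre_quot (mkideal subS)) /preimage /=.
have -> : quot_pi (mkideal subS) x = 0 by apply/pi_eq0.
by have [[]] := centre_sub_skew_brace (quot (mkideal subS)).
Qed.
End Dedekind.

(** * Self-fixed elements modulo ideals *)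

Section Multiples.
Variable B : skewBraceType.
Implicit Types (a b c x y : B) (S I : set B).

Lemma add_subgroup0 : add_subgroup [set (0 : B)].
Proof. by split=> // [x y -> ->|x ->]; rewrite /= ?gadd0 ?gopp0. Qed.

(** Bezout: [c] is a multiple of [nmul n c] when the order of [c] is prime to [n]. *)
Lemma bezout_nmul S m n c : add_subgroup S -> (0 < m)%N -> coprime m n ->
  nmul m c = 0 -> S (nmul n c) -> S c.
Proof.
move=> subS m0 /eqP co mc Snc; case: (egcdnP n m0) => km kn; rewrite co => kE _.
have : nmul (km * m)%N c = 0 by rewrite nmulM mc nmul0.
rewrite kE addn1 nmulSr nmulM => knE.
have -> : c = - nmul kn (nmul n c).
  by apply: (@gaddI _ (nmul kn (nmul n c))); rewrite knE gaddNr.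
by have [_ _ SN] := subS; apply: SN; apply: nmul_sub.
Qed.

Lemma nmul_mod p m c : nmul p c = 0 -> nmul (m %% p)%N c = nmul m c.
Proof. by move=> pc; rewrite [in RHS](divn_eq m p) nmulD nmulM pc nmul0 gadd0. Qed.

(** An automorphism of a group of order [p] is multiplication by some [t], and
[t ^ (p ^ k) = t] modulo [p] by Fermat; one of order dividing [p ^ k] is therefore
the identity. *)
Lemma fixed_of_p_power (f : B -> B) p k t c : prime p -> nmul p c = 0 ->
  (forall n, f (nmul n c) = nmul n (f c)) -> f c = nmul t c ->
  iter (p ^ k)%N f c = c -> f c = c.
Proof.
move=> p_pr pc fZ fc.
have iterE n : iter n f c = nmul (t ^ n)%N c.
  elim: n => [|n IH]; first by rewrite expn0 nmul1.
  by rewrite iterS IH fZ fc -nmulM expnSr.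
rewrite iterE fc => {2}<-; rewrite -(nmul_mod t pc) -(nmul_mod (t ^ _)%N pc).
congr nmul; elim: k => [|k IH]; first by rewrite expn0 expn1.
by rewrite expnSr expnM fermat_little.
Qed.

Lemma gaddrNK x b : x - b + b = x.
Proof. by rewrite -gaddA gaddN gaddr0. Qed.

Lemma conj_add_nmul b n c : b + nmul n c - b = nmul n (b + c - b).
Proof.
elim: n => [|n IH]; first by rewrite gaddr0 gaddNr.
by rewrite !nmulS -IH !gaddA gaddrNK.
Qed.

Lemma iter_conj_add b n c :
  iter n (fun x => b + x - b) c = nmul n b + c - nmul n b.
Proof.
elim: n => [|n IH]; first by rewrite /= gadd0 gopp0 gaddr0.
by rewrite iterS IH nmulS goppD !gaddA.
Qed.

Lemma iter_conj_circ b n c :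
  iter n (fun x => b ∘ x ∘ b^-1%g) c = (b ^+ n)%g ∘ c ∘ (b ^- n)%g.
Proof.
elim: n => [|n IH]; first by rewrite /= expg0 mul1g invg1 mulg1.
by rewrite iterS IH expgS invgM !mulgA.
Qed.

Lemma conj_circ_expg b n c : b ∘ (c ^+ n)%g ∘ b^-1%g = ((b ∘ c ∘ b^-1) ^+ n)%g.
Proof.
elim: n => [|n IH]; first by rewrite !expg0 mulg1 mulgV.
by rewrite !expgS -IH !mulgA mulgVK.
Qed.

Lemma lambda_expg b n x : lambda (b ^+ n)%g x = iter n (lambda b) x.
Proof.
by elim: n => [|n IH]; rewrite ?expg0 ?lambda1 // expgS lambdaM IH.
Qed.

(** Since [a] commutes with its powers, [lambda (a ^+ n)] fixes each
[a ^+ m.+1 = a + lambda a (a ^+ m)] once it fixes [a]. *)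
Lemma selffix_expg a n : lambda (a ^+ n)%g a = a ->
  lambda (a ^+ n)%g (a ^+ n)%g = (a ^+ n)%g.
Proof.
move=> ana; suff H m : lambda (a ^+ n)%g (a ^+ m)%g = (a ^+ m)%g by [].
elim: m => [|m IH]; first by rewrite expg0 brace1E lambda0.
rewrite expgS gmulE lambdaD ana -lambdaM -expgSr expgS lambdaM.
by rewrite IH.
Qed.

Lemma rel_centre0 : rel_centre [set (0 : B)] = centre B.
Proof.
have eq0 x y : - x + y = 0 <-> x = y.
  split=> [H|->]; last exact: gaddN.
  by apply: (@gaddI _ (- x)); rewrite H gaddN.
apply/seteqP; split=> x.
  move=> nx; do 2?split; move=> b; have [/eq0 e1 /eq0 e2 /eq0 e3] := nx b.
  - by rewrite -e1.
  - by rewrite e2.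
  - by rewrite e3.
move=> [[cl ca] cm] b; split; apply/eq0.
- by rewrite cl.
- by rewrite ca.
- by rewrite cm.
Qed.
End Multiples.

(** Every proper sub-skew brace [I] has a self-fixed element outside of it.  In the
Dedekind case [I] is an ideal, and the condition says that the nonzero quotients
have nonzero self-fixed elements. *)
Definition selffixed_rich (B : skewBraceType) : Prop :=
  forall I : set B, sub_skew_brace I -> ~ [set: B] `<=` I ->
  exists a, ~ I a /\ I (- a + lambda a a).

Section RichQuot.
Variables (B : skewBraceType) (I : ideal B).

Lemma rich_quot : selffixed_rich B -> selffixed_rich (quot I).
Proof.
move=> richB S subS propS.
have [|a [Sa aS]] := richB _ (preim_sub_skew_brace subS).
  move=> full; apply: propS => y _; have [x ->] := pi_surj y.
  exact: full.
by exists (quot_pi I a); split=> //; rewrite -pi_lambda -piN -piD.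
Qed.

Lemma selffix_pi a :
  ideal_set I (- a + lambda a a) <-> lambda (quot_pi I a) (quot_pi I a) = quot_pi I a.
Proof. by rewrite -pi_lambda; split=> [/pi_eq ->|eqa]; last exact/pi_eq. Qed.
End RichQuot.

Section ChainUnion.
Variable B : skewBraceType.

Lemma sub_skew_brace0 : sub_skew_brace [set (0 : B)].
Proof.
split; first exact: add_subgroup0.
by split=> [|x y -> ->|x ->]; rewrite /= ?gmul0 // -brace1E ?invg1.
Qed.

(** The set [[set 0]] is added so that the empty chain needs no special treatment. *)
Lemma chain_sub_skew_brace (F : set (set B)) :
  (forall S, F S -> sub_skew_brace S) -> total_on F subset ->
  sub_skew_brace ([set 0] `|` \bigcup_(S in F) S).
Proof.
move=> subF totF; set U := _ `|` _.
have U0 : U 0 by left.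
have UE x y : U x -> U y -> exists S, [/\ sub_skew_brace S, S x, S y & S `<=` U].
  move=> [->|[S FS Sx]] [->|[S' FS' Sy]].
  - exists [set 0]; split=> // [|x' ->//].
    exact: sub_skew_brace0.
  - by exists S'; split=> //; [apply: subF|case: (subF _ FS') => [[]]|right; exists S'].
  - by exists S; split=> //; [apply: subF|case: (subF _ FS) => [[]]|right; exists S].
  - have [le|le] := totF _ _ FS FS'.
      by exists S'; split=> //; [apply: subF|apply: le|right; exists S'].
    by exists S; split=> //; [apply: subF|apply: le|right; exists S].
split; split=> //.
- move=> x y Ux Uy.
  by have [S [[[_ SD _] _] Sx Sy SU]] := UE x y Ux Uy; apply: SU; apply: SD.
- by move=> x Ux; have [S [[[_ _ SN] _] Sx _ SU]] := UE x x Ux Ux; apply: SU; apply: SN.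
- by rewrite brace1E.
- move=> x y Ux Uy.
  by have [S [[_ [_ SM _]] Sx Sy SU]] := UE x y Ux Uy; apply: SU; apply: SM.
- by move=> x Ux; have [S [[_ [_ _ SV]] Sx _ SU]] := UE x x Ux Ux; apply: SU; apply: SV.
Qed.

Lemma maximal_avoiding (c : B) : c <> 0 -> exists N : set B,
  [/\ sub_skew_brace N, ~ N c &
      forall S, sub_skew_brace S -> N `<=` S -> ~ S `<=` N -> S c].
Proof.
move=> c0; pose P S := sub_skew_brace ([set 0] `|` S) /\ ~ S c.
have [|N [[subN Nc] maxN]] := @Zorn_bigcup B P.
  move=> F FP totF; split; last by case=> S /FP[_ Sc].
  suff -> : [set 0] `|` \bigcup_(X in F) X =
      [set 0] `|` \bigcup_(X in [set [set 0] `|` X | X in F]) X.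
    apply: chain_sub_skew_brace => [_ [X /FP[? _] <-] //|].
    move=> _ _ [X FX <-] [Y FY <-]; have [le|le] := totF _ _ FX FY.
      by left; apply: setUS.
    by right; apply: setUS.
  apply/seteqP; split=> x; case; [by left| |by left|].
    by case=> X FX Xx; right; exists ([set 0] `|` X); [exists X|right].
  by case=> _ [X FX <-] [->|Xx]; [left|right; exists X].
exists ([set 0] `|` N); split=> //; first by case.
move=> S subS NS SN; apply: contrapT => Sc; apply: (maxN S).
  split=> [x Nx|SN']; last by apply: SN => x /SN'; right.
  by apply: NS; right.
split=> //; suff -> : [set 0] `|` S = S by [].
by apply/setUidPr => _ ->; case: subS => [[]].
Qed.
End ChainUnion.

(** * Central self-fixed elements in the monolithic case *)

Section FinitePart.
Variables (B : skewBraceType).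
Hypothesis dedB : dedekind B.
Implicit Types (a b c x y : B) (K : set B).

(** The sum of the ideal [K] and of the multiples of [a]. *)
Definition adjoin K (subK : sub_skew_brace K) a : set B :=
  quot_pi (mkideal dedB subK) @^-1` cyc (quot_pi (mkideal dedB subK) a).

Lemma adjoin_id K (subK : sub_skew_brace K) a : adjoin subK a a.
Proof. exact: cyc_id. Qed.

Lemma adjoin_sub_skew_brace K (subK : sub_skew_brace K) a :
  K (- a + lambda a a) -> sub_skew_brace (adjoin subK a).
Proof.
move=> aK; apply: preim_sub_skew_brace; apply: cyc_sub_skew_brace.
by rewrite -pi_lambda; apply/esym/pi_eq.
Qed.

Lemma adjoin_finite K (subK : sub_skew_brace K) a n : finite_set K ->
  (0 < n)%N -> K (nmul n a) -> finite_set (adjoin subK a).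
Proof.
move=> finK n0 Kna; set pi := quot_pi (mkideal dedB subK).
have pina : nmul n (pi a) = 0 by rewrite -pi_nmul; apply/pi_eq0.
apply: (@sub_finite_set _ _ [set nmul m a + k | m in `I_n & k in K]); last first.
  by apply: finite_image2 => //; apply: finite_II.
move=> x /(cycP_fin n0 pina)[m]; rewrite -(nmul_mod _ pina) -pi_nmul.
move=> /esym/pi_eq Kx; exists (m %% n)%N; first by rewrite /= ltn_mod.
by exists (- nmul (m %% n) a + x) => //; rewrite gadd_NK.
Qed.

(** Finite sub-skew braces of a Dedekind skew brace are ideals, so their sums are
again finite sub-skew braces. *)
Lemma join_finite K K' : sub_skew_brace K -> sub_skew_brace K' ->
  finite_set K -> finite_set K' -> exists J,
  [/\ sub_skew_brace J, finite_set J, K `<=` J & K' `<=` J].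
Proof.
move=> subK subK' finK finK'; pose I := mkideal dedB subK.
exists (quot_pi I @^-1` factor I K'); split.
- by apply: preim_sub_skew_brace; apply: factor_sub_skew_brace.
- apply: (@sub_finite_set _ _ [set y + k | y in K' & k in K]); last first.
    exact: finite_image2.
  move=> x [y K'y /pi_eq Kx]; exists y => //.
  by exists (- y + x) => //; rewrite gadd_NK.
- move=> x Kx; exists 0; first by case: subK' => [[]].
  by apply/pi_eq; rewrite gopp0 gadd0.
- by move=> x K'x; exists x.
Qed.

Definition finite_part : set B :=
  [set x | exists K, [/\ sub_skew_brace K, finite_set K & K x]].

Lemma finite_part_sub_skew_brace : sub_skew_brace finite_part.
Proof.
have inJ x y : finite_part x -> finite_part y ->
    exists J, [/\ sub_skew_brace J, finite_set J, J x & J y].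
  move=> [K [subK finK Kx]] [K' [subK' finK' K'y]].
  have [J [subJ finJ KJ K'J]] := join_finite subK subK' finK finK'.
  by exists J; split=> //; [apply: KJ|apply: K'J].
have R0 : finite_part 0 by exists [set 0]; split=> //; exact: sub_skew_brace0.
split; split=> //.
- move=> x y Rx Ry; have [J [subJ finJ Jx Jy]] := inJ x y Rx Ry.
  by exists J; split=> //; case: subJ => [[_ JD _] _]; apply: JD.
- move=> x Rx; have [J [subJ finJ Jx _]] := inJ x x Rx Rx.
  by exists J; split=> //; case: subJ => [[_ _ JN] _]; apply: JN.
- by rewrite brace1E.
- move=> x y Rx Ry; have [J [subJ finJ Jx Jy]] := inJ x y Rx Ry.
  by exists J; split=> //; case: subJ => [_ [_ JM _]]; apply: JM.
- move=> x Rx; have [J [subJ finJ Jx _]] := inJ x x Rx Rx.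
  by exists J; split=> //; case: subJ => [_ [_ _ JV]]; apply: JV.
Qed.

(** The iterates of [lambda a] on [a] stay in the finite set [a + K], and
[lambda a] is injective. *)
Lemma lambda_orbit_finite K a : sub_skew_brace K -> finite_set K ->
  K (- a + lambda a a) ->
  exists2 L, (0 < L)%N & lambda (a ^+ L)%g a = a.
Proof.
move=> subK finK Ka.
have KL x y : K x -> K (lambda y x) by case: (dedB subK) => _ + _ => H; apply: H.
have [[_ KD _] _] := subK.
have orb n : K (- a + iter n (lambda a) a).
  elim: n => [|n IH]; first by rewrite gaddN; case: subK => [[]].
  rewrite iterS -[iter n _ _](gadd_NK a) lambdaD gaddA.
  by apply: KD => //; apply: KL.
have : ~ injective (fun n => iter n (lambda a) a).
  move=> inj; apply: infinite_nat.
  have <- : (fun n => iter n (lambda a) a) @^-1` [set a + k | k in K] = [set: nat].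
    apply/seteqP; split=> // n _ /=; exists (- a + iter n (lambda a) a) => //.
    by rewrite gadd_NK.
  apply: finite_preimage; first by move=> m n _ _; apply: inj.
  exact: finite_image.
move=> notinj; apply: contrapT => noL; apply: notinj => m n.
wlog le : m n / (m <= n)%N => [W|].
  by have [/W//|/ltnW/W H /esym/H] := leqP m n.
rewrite -{1}(subnKC le) iterD => eqmn.
have /lambdaI eqa : lambda (a ^+ m)%g a = lambda (a ^+ m)%g (lambda (a ^+ (n - m))%g a).
  by rewrite !lambda_expg.
apply/eqP; rewrite eqn_leq le leqNgt; apply/negP => lt.
by apply: noL; exists (n - m)%N; rewrite ?subn_gt0.
Qed.

Section Monolith.
Variables (c : B) (p : nat).
Hypotheses (richB : selffixed_rich B) (c0 : c <> 0) (cc : lambda c c = c).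
Hypotheses (p_pr : prime p) (pc : nmul p c = 0).
Hypothesis monolith : forall S : set B,
  sub_skew_brace S -> ~ S `<=` [set 0] -> S c.

(** Write [R] for the finite part.  An [a] self-fixed modulo [R] is self-fixed
modulo a finite [K], and its multiples cannot meet [R], or else [a] would be in
a finite sub-skew brace.  Some power [u = a ^+ L] is self-fixed; it is [nmul L a]
modulo [K], hence of infinite order, and [cyc u] has no room for [c]. *)
Lemma monolith_finite_part : [set: B] `<=` finite_part.
Proof.
apply: contrapT => propR.
have [a [Ra [K [subK finK Ka]]]] := richB finite_part_sub_skew_brace propR.
have [[n [n0 Rna]]|inf] := EM (exists n, (0 < n)%N /\ finite_part (nmul n a)).
  have [K' [subK' finK' K'na]] := Rna.
  have [J [subJ finJ KJ K'J]] := join_finite subK subK' finK finK'.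
  apply: Ra; exists (adjoin subJ a); split; last exact: adjoin_id.
    by apply: adjoin_sub_skew_brace; apply: KJ.
  by apply: adjoin_finite finJ n0 _; apply: K'J.
have [L L0 La] := lambda_orbit_finite subK finK Ka.
have uu := selffix_expg La; set u := (a ^+ L)%g in uu.
pose I := mkideal dedB subK.
have pia : lambda (quot_pi I a) (quot_pi I a) = quot_pi I a by apply/selffix_pi.
have piu : quot_pi I u = nmul L (quot_pi I a).
  rewrite -(cyc_expg pia) /u; elim: (L) => [|n IH]; first by [].
  by rewrite !expgS piM IH.
have nu n : (0 < n)%N -> nmul n u <> 0.
  move=> n0 nu0; apply: inf; exists (n * L)%N; rewrite muln_gt0 n0 L0.
  split=> //; exists K; split=> //; apply/(@pi_eq0 _ I).
  by rewrite pi_nmul nmulM -piu -pi_nmul nu0.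
have : cyc u c.
  apply: monolith; first exact: cyc_sub_skew_brace.
  by move=> /(_ u (cyc_id u)); rewrite -[u]nmul1; apply: nu.
case/cycP=> t cE.
have t0 : (0 < t)%N.
  by case: t cE => // cE; case: c0; case: cE => ->; rewrite ?gopp0.
apply: (nu (p * t)%N); first by rewrite muln_gt0 prime_gt0.
rewrite nmulM; case: cE => cE; first by rewrite -cE.
by move: pc; rewrite cE nmulN => /(congr1 (fun x => - x)); rewrite gopp_K gopp0.
Qed.

(** Any [b] lies in a finite sub-skew brace of [p]-power order, so it acts on
[cyc c] by automorphisms of [p]-power order, which are trivial.  This concerns
[lambda b] and the two conjugations; that [lambda c] fixes [b] then follows from
[c ∘ b = b ∘ c = b + c = c + b]. *)
Lemma monolith_central : centre B c.
Proof.
have [_ cycL [_ cycC]] := dedB (cyc_sub_skew_brace cc).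
have [[_ cycA] _ _] := dedB (cyc_sub_skew_brace cc).
have p0 := prime_gt0 p_pr.
have cycE x : cyc c x -> exists t, x = nmul t c := cycP_fin p0 pc.
suff H b : [/\ lambda b c = c, b + c - b = c & b ∘ c ∘ b^-1%g = c].
  have addC b : c + b = b + c.
    by have [_ e _] := H b; rewrite -{1}e gaddrNK.
  have mulC b : c ∘ b = b ∘ c.
    by have [_ _ e] := H b; rewrite -{1}e mulgVK.
  do 2?split=> //; move=> b; apply: (@gaddI _ c).
  by rewrite -gmulE mulC gmulE addC; have [-> _ _] := H b.
have [K [subK finK Kb]] := monolith_finite_part (I : [set: B] b).
have [n [n0 ord _ pr]] := finite_sub_order subK finK.
have /part_pnat_id : p.-nat n.
  apply/pnatP => // q q_pr q_n; have [x [k [Kx x0 xx kx]]] := pr q q_pr q_n.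
  have /cycP_fin : cyc x c.
    apply: monolith; first exact: cyc_sub_skew_brace.
    by move=> /(_ x (cyc_id x)).
  move=> /(_ _ _ kx)[|m cE]; first by rewrite expn_gt0 prime_gt0.
  apply: contrapT => /negP pq; apply: c0.
  apply: (bezout_nmul (add_subgroup0 B) p0 _ pc (n := (q ^ k)%N)); last first.
    by rewrite cE nmulC kx nmul0.
  by rewrite coprimeXr // prime_coprime // dvdn_prime2 // eq_sym.
rewrite p_part => nE; have [bn bXn] := ord b Kb.
split.
- have [t bc] := cycE _ (cycL b c (cyc_id c)).
  apply: (fixed_of_p_power (f := lambda b) p_pr pc _ bc (k := logn p n)).
    by move=> m; apply: lambda_nmul.
  by rewrite nE -lambda_expg bXn lambda1.
- have [t bc] := cycE _ (cycA c b (cyc_id c)).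
  apply: (fixed_of_p_power (f := fun x => b + x - b) p_pr pc _ bc (k := logn p n)).
    by move=> m /=; rewrite conj_add_nmul.
  by rewrite nE iter_conj_add bn gopp0 gadd0 gaddr0.
- have cycbc := cycC c b (cyc_id c); have [t bc] := cycE _ cycbc.
  apply: (fixed_of_p_power (f := fun x => b ∘ x ∘ b^-1%g) p_pr pc _ bc
    (k := logn p n)).
    move=> m; rewrite -(cyc_expg cc) conj_circ_expg cyc_expg //.
    exact: (cyc_lambda cc).
  by rewrite nE iter_conj_circ bXn invg1 mul1g mulg1.
Qed.
End Monolith.
End FinitePart.

(** * Self-fixed elements of prime or infinite order are central *)

Section SelffixCentral.
Variable B : skewBraceType.
Hypotheses (dedB : dedekind B) (richB : selffixed_rich B).
Implicit Types (a b c x y : B) (S I : set B).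

(** The commutators with [c] lie in both sets. *)
Lemma central_of_disjoint S S' c : rel_centre S c -> rel_centre S' c ->
  S `&` S' `<=` [set 0] -> centre B c.
Proof.
move=> nS nS' dis; rewrite -rel_centre0 => b.
have [s1 s2 s3] := nS b; have [t1 t2 t3] := nS' b.
by split; apply: dis.
Qed.

(** In the quotient by a maximal [N] avoiding [c], all nonzero sub-skew braces
contain the image of [c], so [c] is central modulo [N].  It is also central
modulo the ideal [cyc c], which meets [N] trivially because [c] has prime order. *)
Lemma prime_selffix_central p c : prime p -> lambda c c = c -> nmul p c = 0 ->
  centre B c.
Proof.
move=> p_pr cc pc; have [->|/eqP c0] := eqVneq c 0.
  by have [[]] := centre_sub_skew_brace B.
have [N [subN Nc maxN]] := maximal_avoiding c0.
pose I := mkideal dedB subN; have dedQ := dedekind_quot (I := I) dedB.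
have mono (S : set (quot I)) : sub_skew_brace S -> ~ S `<=` [set 0] -> S (quot_pi I c).
  move=> subS S0; apply: (maxN (quot_pi I @^-1` S)).
  - exact: preim_sub_skew_brace.
  - move=> x /(@pi_eq0 _ I) Nx; rewrite /preimage /= Nx.
    by case: subS => [[]].
  - move=> SN; apply: S0 => y; have [x ->] := pi_surj y => Sx.
    by apply/pi_eq0/SN.
have nN : rel_centre I c.
  rewrite (rel_centre_quot I) /preimage /=.
  apply: (monolith_central dedQ (rich_quot richB) _ _ p_pr _ mono).
  - by move=> /pi_eq0.
  - by rewrite -pi_lambda cc.
  - by rewrite -pi_nmul pc.
apply: (central_of_disjoint nN (S' := cyc c)).
  exact: (sub_rel_centre dedB (cyc_sub_skew_brace cc) (cyc_id c)).
move=> e [Ne ce]; have [m eE] := cycP_fin (prime_gt0 p_pr) pc ce.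
have [/dvdnP[k mE]|pm] := boolP (p %| m)%N.
  by rewrite eE mE nmulM pc nmul0.
case: Nc; apply: (bezout_nmul _ (prime_gt0 p_pr) _ pc (n := m)).
- by have [] := subN.
- by rewrite prime_coprime.
- by rewrite -eE.
Qed.

End SelffixCentral.

Section Reach.
Variable B : skewBraceType.
Hypotheses (dedB : dedekind B) (richB : selffixed_rich B).
Implicit Types (a b c x y : B) (S I : set B).

Lemma rel_centre_prime I p c : sub_skew_brace I -> prime p ->
  I (- c + lambda c c) -> I (nmul p c) -> rel_centre I c.
Proof.
move=> subI p_pr Icc Ipc; pose J := mkideal dedB subI.
rewrite (rel_centre_quot J) /preimage /=.
apply: (prime_selffix_central (dedekind_quot dedB) (rich_quot richB) p_pr).
  exact/(@selffix_pi _ J).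
by rewrite -pi_nmul; apply/(@pi_eq0 _ J).
Qed.

(** Modulo [nmul p c] the order of [c] is [p], for every prime [p]; all commutators
with [c] are thus in the intersection of the groups [cyc (nmul p c)].  A nonzero
element there would be a [t]-multiple of [c] up to sign, with [t > 0] divisible by
every prime. *)
Lemma infinite_selffix_central c : lambda c c = c ->
  (forall n, (0 < n)%N -> nmul n c <> 0) -> centre B c.
Proof.
move=> cc inf.
have nmulI m n : nmul m c = nmul n c -> m = n.
  wlog le : m n / (m <= n)%N => [W|].
    by have [/W//|/ltnW/W H /esym/H] := leqP m n.
  rewrite -{1}(subnKC le) nmulD -{1}[nmul m c]gaddr0 => /gaddI/esym d0.
  apply/eqP; rewrite eqn_leq le leqNgt; apply/negP => lt.
  by apply: (inf (n - m)%N); rewrite ?subn_gt0.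
have nmulNI m n : nmul m c = - nmul n c -> m = 0%N.
  case: m => // m eqm; case: (inf (m.+1 + n)%N) => //.
  by rewrite nmulD eqm gaddN.
have pcS p : sub_skew_brace (cyc (nmul p c)).
  by apply: cyc_sub_skew_brace; apply: (cyc_lambda cc); apply: cyc_nmul.
have nextp p : prime p -> rel_centre (cyc (nmul p c)) c.
  move=> p_pr; apply: (rel_centre_prime (pcS p) p_pr); last exact: cyc_id.
  by rewrite cc gaddN; case: (pcS p) => [[]].
have [q q2 q_pr] := prime_above 1.
rewrite -rel_centre0 => b.
suff dis e : (forall p, prime p -> cyc (nmul p c) e) -> e = 0.
  by split; apply: dis => p /nextp/(_ b)[].
move=> ce; have {q q2 q_pr}[t eE] : exists t, e = nmul t c \/ e = - nmul t c.
  by have /cycP[t] := ce q q_pr; rewrite -nmulM; exists (t * q)%N.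
(* A prime larger than [t] divides [t] only if [t] is zero. *)
have [p lt_tp p_pr] := prime_above t.
have /cycP[s] := ce p p_pr; rewrite -nmulM => eE'.
have tE : t = (s * p)%N \/ t = 0%N.
  case: eE eE' => -> [].
  - by move/nmulI; left.
  - by move/nmulNI; right.
  - by move=> /(congr1 (fun x => - x)); rewrite gopp_K => /nmulNI; right.
  - by move=> /(congr1 (fun x => - x)); rewrite !gopp_K => /nmulI; left.
have {}tE : t = 0%N.
  case: tE => // tE; move: lt_tp; rewrite tE; case: (s) => // s'.
  by rewrite mulSn ltnNge leq_addr.
by case: eE => ->; rewrite tE ?gopp0.
Qed.
End Reach.

(** * The transfinite upper central series *)

Section UpperCentral.
Variable B : skewBraceType.
Hypotheses (dedB : dedekind B) (richB : selffixed_rich B).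
Implicit Types (a b c x y : B) (S I : set B).

Lemma iter_rel_centre_sub_skew_brace m I :
  sub_skew_brace I -> sub_skew_brace (iter m (@rel_centre B) I).
Proof. by move=> subI; elim: m => //= m; apply: rel_centre_sub_skew_brace. Qed.

Lemma iter_rel_centre_le m n I : sub_skew_brace I -> (m <= n)%N ->
  iter m (@rel_centre B) I `<=` iter n (@rel_centre B) I.
Proof.
move=> subI /subnKC <-; elim: (n - m)%N => [|k IH]; first by rewrite addn0.
rewrite addnS iterS => x /IH; apply: sub_rel_centre => //.
exact: iter_rel_centre_sub_skew_brace.
Qed.

(** If [nmul n a] is in [I] and [p] is a prime divisor of [n], then [p] kills
[nmul (n %/ p) a] modulo [I]; so this multiple belongs to the first step, where
[n] can be replaced by [n %/ p].  If no such [n > 0] exists, one step is enough. *)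
Lemma selffix_reached I a : sub_skew_brace I -> I (- a + lambda a a) ->
  exists m, iter m (@rel_centre B) I a.
Proof.
move=> subI Ia.
have [[n [n0 Ina]]|inf] := EM (exists n, (0 < n)%N /\ I (nmul n a)).
  elim/ltn_ind: n I n0 subI Ia Ina => n IH I n0 subI Ia Ina.
  have [n1|n1] := leqP n 1%N.
    have nE : 1%N = n by apply/eqP; rewrite eqn_leq n1 n0.
    by exists 0%N; rewrite /= -[a]nmul1 nE.
  pose p := pdiv n; have p_pr : prime p := pdiv_prime n1.
  have nE : n = (p * (n %/ p))%N by rewrite mulnC divnK ?pdiv_dvd.
  have np0 : (0 < n %/ p)%N by rewrite divn_gt0 ?prime_gt0 // pdiv_leq.
  pose J := mkideal dedB subI.
  have aa : lambda (quot_pi J a) (quot_pi J a) = quot_pi J a by apply/selffix_pi.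
  have nextI : rel_centre I (nmul (n %/ p) a).
    apply: (rel_centre_prime dedB richB subI p_pr); last by rewrite -nmulM -nE.
    apply/(@selffix_pi _ J); rewrite pi_nmul.
    by apply: (cyc_lambda aa); apply: cyc_nmul.
  have [] := IH _ _ (rel_centre I) np0 _ _ nextI.
  - by rewrite ltn_Pdiv ?prime_gt1.
  - exact: rel_centre_sub_skew_brace.
  - exact: sub_rel_centre.
  by move=> m Hm; exists m.+1; rewrite iterSr.
exists 1%N => /=; pose J := mkideal dedB subI.
rewrite (rel_centre_quot J) /preimage /=.
apply: (infinite_selffix_central (dedekind_quot dedB) (rich_quot richB)).
  exact/(@selffix_pi _ J).
move=> n n0; rewrite -pi_nmul => /(@pi_eq0 _ J) Ina.
by apply: inf; exists n.
Qed.

(** A stationary upper central series reaches no new self-fixed element. *)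
Lemma rel_centre_stationary S :
  sub_skew_brace S -> rel_centre S `<=` S -> [set: B] `<=` S.
Proof.
move=> subS stat; apply: contrapT => propS.
have [a [Sa aS]] := richB subS propS.
have [m Hm] := selffix_reached subS aS; apply: Sa.
have : iter m (@rel_centre B) S `<=` S; last exact.
elim: m {Hm} => //= m IH; apply: subset_trans stat; exact: rel_centre_mono.
Qed.

(** The terms of the upper central series, generated without ordinals as the least
family closed under successor steps and under unions.  Putting [[set 0]] in each
union makes the empty union the bottom term. *)
Inductive tower : set B -> Prop :=
| TowerUnion (F : set (set B)) : (forall S, F S -> tower S) ->
    tower ([set 0] `|` \bigcup_(S in F) S)
| TowerNext S : tower S -> tower (rel_centre S).

(** This uses only that [rel_centre] is monotone.  The case of a successor
[rel_centre X] rests on the claim [inner] that no term of the tower lies strictly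
between [X] and [rel_centre X]. *)
Lemma tower_dichotomy S S' : tower S -> tower S' ->
  S `<=` S' \/ rel_centre S' `<=` S.
Proof.
have sub0 F (U : set B) : U 0 -> (forall S, F S -> S `<=` U) ->
    [set 0] `|` \bigcup_(S in F) S `<=` U.
  by move=> U0 FU x [-> //|[X FX Xx]]; apply: (FU X).
have zero : forall T, tower T -> T 0.
  move=> T; elim=> [F _ _|X _ X0]; first by left.
  move=> b; split; rewrite ?lambda0l ?gaddr0 ?gadd0 ?gmul0 ?gaddN //.
  by rewrite -brace1E mul1g gaddN.
move=> towS; elim: towS S' => [F towF IH|X towX IH] Y towY.
  have [all|] := EM (forall S, F S -> S `<=` Y).
    by left; apply: sub0 => //; apply: zero.
  move=> /existsNP[X /not_implyP[FX XY]]; right=> x nYx; right; exists X => //.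
  by have [|] := IH X FX Y towY => // H; apply: H.
(* No term lies strictly between [X] and its successor. *)
have inner Z : tower Z -> Z `<=` X \/ rel_centre X `<=` Z.
  elim=> [F towF IHF|Z' towZ' _].
    have [all|] := EM (forall S, F S -> S `<=` X).
      by left; apply: sub0 => //; apply: zero.
    move=> /existsNP[W /not_implyP[FW WX]]; right=> x nXx; right; exists W => //.
    by have [|] := IHF W FW => // H; apply: H.
  have [XZ|] := IH Z' towZ'; last by left.
  by right; apply: rel_centre_mono.
by have [YX|] := inner Y towY; [right; apply: rel_centre_mono|left].
Qed.

Lemma tower_sub_skew_brace S : tower S -> sub_skew_brace S.
Proof.
elim=> [F towF subF|X _]; last exact: rel_centre_sub_skew_brace.
apply: chain_sub_skew_brace => // X Y FX FY.
have [|YX] := tower_dichotomy (towF X FX) (towF Y FY); first by left.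
by right; apply: subset_trans YX; apply: sub_rel_centre => //; apply: subF.
Qed.

Lemma tower_total S S' : tower S -> tower S' -> S `<=` S' \/ S' `<=` S.
Proof.
move=> tS tS'; have [|SS'] := tower_dichotomy tS tS'; first by left.
by right; apply: subset_trans SS'; apply: sub_rel_centre => //; apply: tower_sub_skew_brace.
Qed.

Definition stage : Type := {S : set B | tower S}.
Definition stage_le : rel stage := fun s s' => `[< sval s `<=` sval s' >].

Lemma stage_leP (s s' : stage) : stage_le s s' <-> sval s `<=` sval s'.
Proof. by split=> /asboolP. Qed.

Lemma stage_anti (s s' : stage) : sval s `<=` sval s' -> sval s' `<=` sval s -> s = s'.
Proof.
case: s s' => [s tS] [s' tS'] /= le ge.
by apply: eq_exist; apply/seteqP.
Qed.

Definition stage_succ (s : stage) : stage := exist _ _ (TowerNext (svalP s)).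
Definition stage_union (F : set stage) : stage.
Proof.
exists ([set 0] `|` \bigcup_(s in [set sval s | s in F]) s).
by apply: TowerUnion => _ [s _ <-]; apply: svalP.
Defined.

Lemma stage_sub (s : stage) : sub_skew_brace (sval s).
Proof. exact: tower_sub_skew_brace (svalP s). Qed.

Lemma stage_union_ge (F : set stage) (s : stage) : F s -> sval s `<=` sval (stage_union F).
Proof. by move=> FS x Sx; right; exists (sval s) => //; exists s. Qed.

Lemma stage_union_le (F : set stage) (s : stage) :
  (forall s', F s' -> sval s' `<=` sval s) -> sval (stage_union F) `<=` sval s.
Proof.
move=> H x [->|[_ [s' FS' <-] s'x]]; last exact: H FS' _ s'x.
by case: (stage_sub s) => [[]].
Qed.

(** The union [m] of the terms below all members of [A] is the only candidate.  If
it were not a member, each member would contain [rel_centre m], so that [m] would be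
stationary, hence everything. *)
Lemma stage_well_order : well_order stage_le.
Proof.
apply: antisymmetric_well_order.
  by move=> s s' /andP[/stage_leP le /stage_leP ge]; apply: stage_anti.
move=> A [s0 AS0].
pose m := stage_union [set s | forall s', s' \in A -> sval s `<=` sval s'].
have mle s' : s' \in A -> sval m `<=` sval s'.
  by move=> AS'; apply: stage_union_le => s; apply.
suff Am : m \in A by exists m; split=> // s' AS'; apply/stage_leP/mle.
apply: contrapT => Am.
have nm s' : s' \in A -> rel_centre (sval m) `<=` sval s'.
  move=> AS'; have [s'm|//] := tower_dichotomy (svalP s') (svalP m).
  by case: Am; have <- : s' = m by apply: stage_anti => //; apply: mle.
have stat : rel_centre (sval m) `<=` sval m.
  by apply: (@stage_union_ge _ (stage_succ m)) => s' /nm.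
have full := rel_centre_stationary (stage_sub m) stat.
by apply: Am; have <- : s0 = m by apply: stage_anti; [move=> x _; apply: full|apply: mle].
Qed.

Definition stage_ideal (s : stage) : ideal B := mkideal dedB (stage_sub s).

Lemma hypercentral_of_rich : hypercentral B.
Proof.
pose top := stage_union setT.
have topP (s : stage) : sval s `<=` sval top by exact: (@stage_union_ge setT).
exists stage, stage_le, top, stage_ideal; split.
- exact: stage_well_order.
- by move=> s; apply/stage_leP.
- split.
  + move=> s first; apply/seteqP; split=> /=; last first.
      by move=> x ->; case: (stage_sub s) => [[]].
    have /stage_leP le := first (stage_union set0).
    move=> x /le [//|[_ [s' []]]].
  + move=> s s' [[/stage_leP le ne] succ].
    have nextle : sval s' `<=` rel_centre (sval s).
      apply/(stage_leP s' (stage_succ s)); apply: succ; split.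
        by apply/stage_leP; apply: sub_rel_centre => //; apply: stage_sub.
      move=> eqS; apply: ne; apply: stage_anti => // x _.
      apply: (rel_centre_stationary (stage_sub s)) => //.
      by rewrite {2}eqS.
    have -> : s' = stage_succ s.
      apply: stage_anti => //.
      have [s's|//] := tower_dichotomy (svalP s') (svalP s).
      by case: ne; apply: stage_anti.
    split; first by apply: sub_rel_centre => //; apply: stage_sub.
    exact: (factor_rel_centre (stage_ideal s)).
  + move=> s [notfirst notsucc].
    pose U := stage_union [set s' | wo_lt stage_le s' s].
    have US : sval U `<=` sval s by apply: stage_union_le => s' [/stage_leP].
    have SU : s = U.
      apply: contrapT => ne; apply: notsucc; exists U; split.
        by split; [apply/stage_leP|move=> e; apply: ne].
      move=> Z [/stage_leP UZ neUZ]; apply/stage_leP.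
      have [ZS|] := tower_total (svalP Z) (svalP s); last by [].
      have [->//|neZ] := pselect (Z = s).
      case: neUZ; apply: stage_anti => //.
      by apply: stage_union_ge; split=> //; apply/stage_leP.
    rewrite {1}SU; apply/seteqP; split=> /= x.
      move=> [->|[_ [s' lt <-] s'x]]; last by exists s'.
      apply: contrapT => no; apply: notfirst => s'; apply/stage_leP.
      have [//|s's] := tower_total (svalP s) (svalP s').
      have [->//|neS] := pselect (s' = s).
      case: no; exists s'; first by split=> //; apply/stage_leP.
      by case: (stage_sub s') => [[]].
    by move=> [s' lt s'x]; right; exists (sval s') => //; exists s'.
apply/seteqP; split=> // x _; apply: (rel_centre_stationary (stage_sub top)) => //.
exact: (topP (stage_succ top)).
Qed.

End UpperCentral.

(** * The classes of skew braces and the theorem *)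

Section Factors.
Variable B : skewBraceType.
Hypothesis dedB : dedekind B.
Implicit Types (I : set B) (J K : ideal B).

Definition meets_selffix I (K : set B) : Prop :=
  exists a, [/\ K a, ~ I a & I (- a + lambda a a)].

(** The image of [K] modulo [I] is a quotient of the finite [K/J], so
[finite_sub_selffix] applies to it. *)
Lemma finite_factor_selffix I J K : sub_skew_brace I -> J `<=` I -> ~ K `<=` I ->
  finite_set (factor J K) -> meets_selffix I K.
Proof.
move=> subI JI KI finJK; pose Q := mkideal dedB subI.
have subS := factor_sub_skew_brace Q (ideal_sub_skew_brace K).
have finS : finite_set (factor Q K).
  pose f (y : quot J) := quot_pi Q (generic_quotient.repr y).
  apply: (@sub_finite_set _ _ [set f y | y in factor J K]); last exact: finite_image.
  move=> _ [x Kx <-]; exists (quot_pi J x); first by exists x.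
  apply/pi_eq/JI/(@pi_eq _ J); exact: quot_reprK.
have [|_ [[a Ka <-] a0 aa]] := finite_sub_selffix subS finS.
  move=> S0; apply: KI => x Kx; apply/(@pi_eq0 _ Q)/S0.
  by exists x.
exists a; split=> //; first by move=> /(@pi_eq0 _ Q).
exact/(@selffix_pi _ Q).
Qed.

Lemma selffix_factor I J K :
  (forall y : quot J, factor J K y -> lambda y y = y) ->
  J `<=` I -> ~ K `<=` I -> meets_selffix I K.
Proof.
move=> fix_ JI /existsNP[a /not_implyP[Ka Ia]]; exists a; split=> //.
by apply/JI/selffix_pi/fix_; exists a.
Qed.

Lemma polycyclic_selffix I J K : sub_skew_brace I -> J `<=` I -> ~ K `<=` I ->
  polycyclic_factor (factor J K) -> meets_selffix I K.
Proof.
move=> subI JI KI [[soc _]|]; last exact: finite_factor_selffix.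
by apply: selffix_factor JI KI => y /soc[].
Qed.
End Factors.

Lemma supersoluble_polycyclic (Q : skewBraceType) (A : set Q) :
  supersoluble_factor A -> polycyclic_factor A.
Proof.
move=> [[soc [_ [g AE]]]|[p [_ card_A]]]; last first.
  by right; apply/finite_setP; exists p.
left; split=> //; exists [set g]; split; first exact: finite_set1.
have gg : lambda g g = g by have [] : socle Q g by apply: soc; rewrite AE; apply: cyc_id.
apply/seteqP; split; rewrite AE.
  by move=> x gx M [[addM _] gM]; apply: gx.
by apply: smallest_sub; [apply: cyc_sub_skew_brace|move=> _ ->; apply: cyc_id].
Qed.

Section Series.
Variables (P : factor_condition) (B : skewBraceType).
Hypothesis selffixP : forall (I : set B) (J K : ideal B), sub_skew_brace I ->
  J `<=` I -> ~ K `<=` I -> P (factor J K) -> meets_selffix I K.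

(** The first term of the series outside [I] is neither the bottom nor a limit. *)
Lemma rich_of_ascending : has_ascending_series P B -> selffixed_rich B.
Proof.
move=> [W [R [top [s [wo topP [s0 ssucc slim] sT]]]]] I subI propI.
pose A : {pred W} := fun w => `[< ~ s w `<=` I >].
have At : top \in A by apply/asboolP; rewrite sT.
have [|w [[/asboolP Aw wmin] _]] := wo A; first by exists top.
have refl x : R x x.
  have [|z [[/asboolP zx zmin] _]] := wo (fun y => `[< y = x >]).
    by exists x; apply/asboolP.
  by have := zmin x; rewrite zx; apply; apply/asboolP.
(* Reflexivity and antisymmetry come from the unique minima of sets with one or
   two elements. *)
have anti x y : R x y -> R y x -> x = y.
  move=> xy yx.
  have [|z [_ uniq]] := wo (fun u => `[< u = x \/ u = y >]).
    by exists x; apply/asboolP; left.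
  transitivity z; [apply/esym|]; apply: uniq; split.
  - by apply/asboolP; left.
  - by move=> u /asboolP[] ->.
  - by apply/asboolP; right.
  - by move=> u /asboolP[] ->.
have below v : wo_lt R v w -> s v `<=` I.
  move=> [vw neq]; apply: contrapT => /asboolT Av; apply: neq.
  by apply: anti => //; apply: wmin.
have [/s0 sw|nfirst] := EM (wo_first R w).
  by case: Aw; rewrite sw => _ ->; case: subI => [[]].
have [[v vw]|nsucc] := EM (exists v, wo_succ R v w).
  have [sub Pvw] := ssucc v w vw; have [lt_vw _] := vw.
  have [a [_ Ia aa]] := selffixP subI (below v lt_vw) Aw Pvw.
  by exists a.
case: Aw; rewrite (slim w (conj nfirst nsucc)) => x [v vw].
exact: below.
Qed.

Lemma rich_of_finite : has_finite_series P B -> selffixed_rich B.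
Proof.
move=> [n [s [s0 sn step]]] I subI propI.
have ex : exists i, `[< ~ s i `<=` I >] by exists n; apply/asboolP; rewrite sn.
have [i /asboolP si imin] := ex_minnP ex.
case: i si imin => [|i] si imin.
  by case: si; rewrite s0 => _ ->; case: subI => [[]].
have lt_in : (i < n)%N.
  by apply: imin; apply/asboolP; rewrite sn.
have [sub Pi] := step i lt_in.
have [|a [_ Ia aa]] := selffixP subI _ si Pi; last by exists a.
by apply: contrapT => /asboolT/imin; rewrite ltnn.
Qed.
End Series.

Section FiniteLength.
Variable B : skewBraceType.
Hypotheses (dedB : dedekind B) (richB : selffixed_rich B).
Local Notation Z m := (iter m (@rel_centre B) [set 0]).

Let Zsub m : sub_skew_brace (Z m).
Proof. exact/iter_rel_centre_sub_skew_brace/sub_skew_brace0. Qed.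

Let Zle m n : (m <= n)%N -> Z m `<=` Z n.
Proof. exact/iter_rel_centre_le/sub_skew_brace0. Qed.

(** Used to reach finitely many elements at a single stage. *)
Lemma finite_uniform_stage (T : eqType) (F : set T) (E : nat -> T -> Prop) :
  finite_set F -> (forall m n y, (m <= n)%N -> E m y -> E n y) ->
  exists N, forall y m, F y -> E m y -> E N y.
Proof.
move=> /finite_seqP[s ->] mono; elim: s => [|x s [N HN]]; first by exists 0%N.
have [[k Ek]|no] := EM (exists k, E k x); last first.
  exists N => y m; rewrite /= inE => /orP[/eqP -> Em|ys]; last exact: HN.
  by case: no; exists m.
exists (maxn N k) => y m; rewrite /= inE => /orP[/eqP -> _|ys Em].
  by apply: mono Ek; rewrite leq_maxr.
by apply: (mono N); [rewrite leq_maxl|apply: HN Em].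
Qed.

(** A finitely generated factor in the socle has finitely many generators, all
self-fixed, hence all reached at one stage.  For a finite factor, take a
stage containing everything in the factor that is ever reached: were it not all of
[K], a new self-fixed element of [K] would be reached later. *)
Lemma polycyclic_reached (J K : ideal B) m : J `<=` Z m ->
  polycyclic_factor (factor J K) -> exists m', K `<=` Z m'.
Proof.
move=> JZ polyJK.
have facI n x : (m <= n)%N -> factor J (Z n) (quot_pi J x) -> Z n x.
  move=> mn [z Zz /pi_eq Jzx]; rewrite -(gadd_NK z x).
  have [[_ ZD _] _] := Zsub n; apply: ZD => //.
  exact: Zle mn _ (JZ _ Jzx).
have mono k n y : (k <= n)%N -> factor J (Z k) y -> factor J (Z n) y.
  by move=> kn [z Zz <-]; exists z => //; apply: Zle kn _ Zz.
have reach n a : Z n (- a + lambda a a) -> exists k, Z k a.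
  move=> /(selffix_reached dedB richB (Zsub n))[k]; rewrite -iterD => Zk.
  by exists (k + n)%N.
case: polyJK => [[soc [X [finX AE]]]|finA].
  have [N HN] := finite_uniform_stage finX mono.
  have XN : X `<=` factor J (Z (maxn N m)).
    move=> y Xy; have [x Kx xE] : factor J K y by rewrite AE => M [_]; apply.
    have [|k Zk] := reach m x.
      apply/JZ/selffix_pi; have [] : socle _ (quot_pi J x); last by move=> H _.
      by apply: soc; exists x.
    apply: (mono N); first exact: leq_maxl.
    by apply: (HN _ k) => //; exists x.
  exists (maxn N m) => x Kx; apply: facI; first exact: leq_maxr.
  have : factor J K (quot_pi J x) by exists x.
  by rewrite AE; apply; split=> //; apply: factor_sub_skew_brace.
have [N HN] := finite_uniform_stage finA mono.
exists (maxn N m); apply: contrapT => KZ.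
have JZm : J `<=` Z (maxn N m) := subset_trans JZ (Zle (leq_maxr N m)).
have [a [Ka Za /reach[k Zk]]] :=
  finite_factor_selffix dedB (Zsub (maxn N m)) JZm KZ finA.
apply: Za; apply: facI; first exact: leq_maxr.
apply: (mono N); first exact: leq_maxl.
by apply: (HN _ k); exists a.
Qed.

Lemma centrally_nilpotent_of_polycyclic :
  almost_polycyclic B -> centrally_nilpotent B.
Proof.
move=> [n [s [s0 sn step]]].
have reached i : (i <= n)%N -> exists m, s i `<=` Z m.
  elim: i => [|i IH] lt_in; first by exists 0%N; rewrite s0.
  have [m sm] := IH (ltnW lt_in); have [_ poly] := step i lt_in.
  exact: polycyclic_reached sm poly.
have [m full] := reached n (leqnn n).
exists m, (fun i => mkideal dedB (Zsub i)); split=> //.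
  by apply/seteqP; split=> // x _; apply: full; rewrite sn.
move=> i _; split; first exact: (sub_rel_centre dedB (Zsub i)).
exact: (factor_rel_centre (mkideal dedB (Zsub i))).
Qed.
End FiniteLength.

Section Classes.
Variable B : skewBraceType.
Hypothesis dedB : dedekind B.

Lemma polycyclic_rich : almost_polycyclic B -> selffixed_rich B.
Proof. by apply: rich_of_finite => I J K subI; apply: polycyclic_selffix. Qed.

Lemma hypercyclic_rich : hypercyclic B -> selffixed_rich B.
Proof.
apply: rich_of_ascending => I J K subI JI KI /supersoluble_polycyclic.
exact: polycyclic_selffix.
Qed.

Lemma soluble_rich : soluble B -> selffixed_rich B.
Proof.
apply: rich_of_finite => I J K subI JI KI ab; apply: selffix_factor JI KI.
move=> y Jy; have [yy _] := ab y y Jy Jy.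
by apply: (@gaddI _ y); rewrite -gmulE -yy.
Qed.

Lemma hypermultipermutational_rich : hypermultipermutational B -> selffixed_rich B.
Proof.
apply: rich_of_ascending => I J K subI JI KI soc; apply: selffix_factor JI KI.
by move=> y; rewrite soc => -[].
Qed.

Lemma locally_finite_rich : locally_finite B -> selffixed_rich B.
Proof.
move=> lf I subI /existsNP[b /not_implyP[_ Ib]].
pose S := smallest (@sub_skew_brace B) [set b].
have subS : sub_skew_brace S.
  split; split.
  - by move=> M [[[]]].
  - by move=> x y Sx Sy M HM; have [[[_ MD _] _] _] := HM; apply: MD; [apply: Sx|apply: Sy].
  - by move=> x Sx M HM; have [[[_ _ MN] _] _] := HM; apply: MN; apply: Sx.
  - by move=> M [[_ []]].
  - by move=> x y Sx Sy M HM; have [[_ [_ MM _]] _] := HM; apply: MM; [apply: Sx|apply: Sy].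
  - by move=> x Sx M HM; have [[_ [_ _ MV]] _] := HM; apply: MV; apply: Sx.
have Sb : S b by move=> M [_]; apply.
have finS : finite_set S by apply: lf => //; exists [set b]; split=> //; apply: finite_set1.
have [|||a [_ Ia aa]] := finite_factor_selffix dedB (I := I)
    (J := mkideal dedB (sub_skew_brace0 B)) (K := mkideal dedB subS) subI.
- by move=> _ ->; case: subI => [[]].
- by move=> SI; apply/Ib/SI.
- exact: finite_image.
by exists a.
Qed.

Lemma finite_polycyclic : finite_set [set: B] -> almost_polycyclic B.
Proof.
move=> finB.
have subT : sub_skew_brace [set: B] by [].
exists 1%N, (fun i => if i is 0%N then mkideal dedB (sub_skew_brace0 B)
                      else mkideal dedB subT).
split=> // -[|//] _; split=> //; right; exact: finite_image.
Qed.

Lemma supersoluble_almost_polycyclic : supersoluble B -> almost_polycyclic B.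
Proof.
move=> [n [s [s0 sn step]]]; exists n, s; split=> // i /step[sub fac].
by split=> //; apply: supersoluble_polycyclic.
Qed.
End Classes.

Theorem corollary3p7 (B : skewBraceType) (dedB : dedekind B) :
  (finite_set [set: B]%classic \/ almost_polycyclic B \/ supersoluble B ->
     centrally_nilpotent B) /\
  (locally_finite B \/ soluble B \/ hypercyclic B \/ hypermultipermutational B ->
     hypercentral B).
Proof.
split=> hyp.
  have poly : almost_polycyclic B.
    case: hyp => [|[//|]]; first exact: finite_polycyclic.
    exact: supersoluble_almost_polycyclic.
  exact: (centrally_nilpotent_of_polycyclic dedB (polycyclic_rich dedB poly) poly).
apply: (hypercentral_of_rich dedB); case: hyp => [|[|[]]].
- exact: locally_finite_rich.
- exact: soluble_rich.
- exact: hypercyclic_rich.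
- exact: hypermultipermutational_rich.
Qed.
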